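(* Let $f:\Sigma\to\mathcal{Z}$ be an umbilic-free Lie applicable surface with quadratic differential $q$ of constant signature, and let $\hat{f}=s_{0}\oplus\hat{s}$ be a Darboux transform of $f$ with parameter $m$, where $s_{0}=f\cap\hat{f}$. Then $p\in\Sigma$ is an umbilic point of $\hat{f}$ if and only if $s_{0}$ coincides at $p$ with one of the isothermic sphere congruences $s^{\pm}$ of $f$.
   Context: All objects are smooth. $\mathbb{R}^{4,2}$ is a six-dimensional real vector space with a symmetric bilinear form $(\cdot,\cdot)$ of signature $(4,2)$, and $\mathcal{Z}$ is the Grassmannian of its isotropic 2-dimensional subspaces. $\wedge^{2}\mathbb{R}^{4,2}$ is identified with $\mathfrak{o}(4,2)$ via $(a\wedge b)c=(a,c)b-(b,c)a$. $\Sigma$ is a 2-manifold, $\underline{\mathbb{R}}^{4,2}=\Sigma\times\mathbb{R}^{4,2}$ with trivial connection $d$; $\Gamma$ denotes sections, $\Omega^{k}(E)$ the $E$-valued $k$-forms. For a subbundle $W\le\underline{\mathbb{R}}^{4,2}$, $W^{(1)}$ is spanned by sections of $W$ and their first derivatives. A map $f:\Sigma\to\mathcal{Z}$, viewed as a rank 2 subbundle of $\underline{\mathbb{R}}^{4,2}$, is a Legendre immersion if $f^{(1)}=f^{\perp}$ and, for $X\in T_{p}\Sigma$, $d_{X}\sigma\in f(p)$ for all $\sigma\in\Gamma f$ implies $X=0$. A curvature sphere of $f$ at $p$ is a 1-dimensional $s(p)\le f(p)$ for which there is a non-zero subspace $T_{s(p)}\le T_{p}\Sigma$ (the maximal one is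 the curvature space) with $d_{X}\sigma\in f(p)$ for all $X\in T_{s(p)}$ and $\sigma\in\Gamma f$ with $\sigma(p)\in s(p)$. At each point there are one or two curvature spheres; $p$ is umbilic if there is exactly one (then its curvature space is $T_{p}\Sigma$). If $f$ is umbilic-free the curvature spheres form rank 1 subbundles $s_{1},s_{2}$ with $f=s_{1}\oplus s_{2}$ and curvature subbundles $T_{1},T_{2}$ with $T\Sigma=T_{1}\oplus T_{2}$. For $\eta\in\Omega^{1}(f\wedge f^{\perp})$ put $q(X,Y)=\mathrm{tr}(f\to f,\ \sigma\mapsto\eta(X)d_{Y}\sigma)$. $f$ (a Legendre immersion) is Lie applicable if there is a closed $\eta\in\Omega^{1}(f\wedge f^{\perp})$ with $[\eta\wedge\eta]=0$ and $q$ non-zero. The gauge orbit is $[\eta]=\{\eta-d\tau:\tau\in\Gamma(\wedge^{2}f)\}$; $q$ depends only on $[\eta]$. Normalisation: $q\in\Gamma((T_{1}^{*})^{2}\oplus(T_{2}^{*})^{2})$; up to the sign of $q$ and the ordering of $T_{1},T_{2}$, $q=-\epsilon^{2}q_{1}+q_{2}$ with $\epsilon\in\{0,1,i\}$ and $q_{j}\in\Gamma(T_{j}^{*})^{2}$ positive definite. Let $\sigma_{1}\in\Gamma s_{1}$, $\sigma_{2}\in\Gamma s_{2}$ be the lifts (unique up to sign) with $q_{2}=(d\sigma_{1},d\sigma_{1})$ and $q_{1}=(d\sigma_{2},d\sigma_{2})$ (if $\epsilon=0$, $\sigma_{2}$ is any lift with $d_{Y}\sigma_{2}\in\Gamma s_{1}$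 for $Y\in\Gamma T_{2}$). The isothermic sphere congruences of $f$ are $s^{\pm}=\langle\sigma_{1}\pm\epsilon\sigma_{2}\rangle$ (complex conjugate if $\epsilon=i$; both equal to $s_{1}$ if $\epsilon=0$). Darboux transforms: for $m\in\mathbb{R}\setminus\{0\}$ the connection $d+m\eta$ is flat. Let $\hat{s}\le\underline{\mathbb{R}}^{4,2}$ be a null rank 1 subbundle, parallel for $d+m\eta$, nowhere orthogonal to the curvature spheres of $f$. Put $s_{0}=\hat{s}^{\perp}\cap f$. Then $\hat{f}=s_{0}\oplus\hat{s}$ is a Legendre immersion, called a Darboux transform of $f$ with parameter $m$; it depends only on the gauge orbit of $\eta$ (replacing $\eta$ by $\eta-d\tau$ replaces $\hat{s}$ by $\exp(m\tau)\hat{s}\le\hat{f}$). *)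

(* Defs.v *)
From HB Require Import structures.
From mathcomp Require Import all_boot all_order all_algebra.
From mathcomp Require Import all_classical all_reals all_analysis.
From mathcomp Require Export complex.

Set Implicit Arguments.
Unset Strict Implicit.
Unset Printing Implicit Defensive.

Import Order.TTheory GRing.Theory Num.Theory.
Import numFieldNormedType.Exports.

Local Open Scope classical_set_scope.
Local Open Scope ring_scope.
Local Open Scope complex_scope.

Section LinearSpan.
Variables (R : realType) (V : lmodType R).

Definition lspan (S : set V) : set V :=
  [set v | exists n (a : 'I_n -> R) (w : 'I_n -> V),
     (forall i, S (w i)) /\ v = \sum_i a i *: w i].

End LinearSpan.

Section SmoothSurfaces.
Variable R : realType.

Fixpoint Ck (W : normedModType R) (k : nat) (U : set 'rV[R]_2)
    (g : 'rV[R]_2 -> W) : Prop :=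
  match k with
  | 0 => forall x, U x -> {for x, continuous g}
  | k'.+1 => (forall x, U x -> differentiable g x) /\
             forall i : 'I_2, Ck k' U ('D_(delta_mx 0 i) g)
  end.

Definition Cinfty (W : normedModType R) (U : set 'rV[R]_2)
    (g : 'rV[R]_2 -> W) := forall k, Ck k U g.

(* A homeomorphism between open sets [cdom] and [ccod]; the values of [cmap]
   and [cinv] outside these sets are irrelevant. *)
Record chart (T : topologicalType) := Chart {
  cdom : set T;
  ccod : set 'rV[R]_2;
  cmap : T -> 'rV[R]_2;
  cinv : 'rV[R]_2 -> T;
  cdom_open : open cdom;
  ccod_open : open ccod;
  cmap_cod : forall p, cdom p -> ccod (cmap p);
  cinv_dom : forall x, ccod x -> cdom (cinv x);
  cmapK : forall p, cdom p -> cinv (cmap p) = p;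
  cinvK : forall x, ccod x -> cmap (cinv x) = x;
  cmap_continuous : forall p, cdom p -> {for p, continuous cmap};
  cinv_continuous : forall x, ccod x -> {for x, continuous cinv}
}.

Record surface := Surface {
  carrier :> topologicalType;
  surface_hausdorff : hausdorff_space carrier;
  surface_second_countable : @second_countable carrier;
  atlas : set (chart carrier);
  chart_at : carrier -> chart carrier;
  chart_at_atlas : forall p, atlas (chart_at p);
  chart_at_dom : forall p, cdom (chart_at p) p;
  atlas_smooth : forall c c', atlas c -> atlas c' ->
    Cinfty (ccod c `&` cinv c @^-1` cdom c') (cmap c' \o cinv c)
}.

Variable Sigma : surface.

(* The tangent space at [p] is modelled on 'rV[R]_2 through the preferred
   chart [chart_at p]. *)
Definition dd (W : normedModType R) (s : Sigma -> W) (p : Sigma)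
    (X : 'rV[R]_2) : W :=
  'D_X (s \o cinv (chart_at p)) (cmap (chart_at p) p).

Definition smooth_on (W : normedModType R) (U : set Sigma) (s : Sigma -> W) :=
  forall c, atlas c -> Cinfty (ccod c `&` cinv c @^-1` U) (s \o cinv c).

(* The coordinate vector d/dx_i of the chart [c] at [cinv c x], read in the
   tangent space at that point, i.e. in the preferred chart there. *)
Definition coord_vector (c : chart Sigma) (i : 'I_2) (x : 'rV[R]_2) :
    'rV[R]_2 :=
  'D_(delta_mx 0 i) (cmap (chart_at (cinv c x)) \o cinv c) x.

Section Forms.
Variable W : normedModType R.
Variable eta : Sigma -> {linear 'rV[R]_2 -> W}.

Definition form_coef (c : chart Sigma) (i : 'I_2) (x : 'rV[R]_2) : W :=
  eta (cinv c x) (coord_vector c i x).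

Definition smooth_form := forall c i, atlas c -> Cinfty (ccod c) (form_coef c i).

Definition closed_form := forall c x, atlas c -> ccod c x ->
  'D_(delta_mx 0 0) (form_coef c 1) x = 'D_(delta_mx 0 1) (form_coef c 0) x.

End Forms.

End SmoothSurfaces.

Section LieSphereGeometry.
Variable R : realType.

Local Notation V := 'cV[R]_6.

Definition gram42 : 'M[R]_6 := diag_mx (\row_i (if (i < 4)%N then 1 else -1)).

Definition mink (u v : V) : R := (u^T *m gram42 *m v) 0 0.

Definition perp (U : {vspace V}) : {vspace V} :=
  lker (linfun (fun v => \col_(i < \dim U) mink (vbasis U)`_i v)).

Lemma memv_perp (U : {vspace V}) (v : V) :
  v \in perp U <-> forall u, u \in U -> mink u v = 0.
Proof.
have minkr a w x y : mink w (a *: x + y) = a * mink w x + mink w y.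
  by rewrite /mink mulmxDr -scalemxAr [LHS]mxE [X in X + _]mxE.
pose g (w : V) := \col_(i < \dim U) mink (vbasis U)`_i w.
have gL : linear g.
  by move=> a x y; apply/colP => i; rewrite mxE minkr !mxE.
pose gl := HB.pack_for {linear V -> 'cV[R]_(\dim U)} g
  (GRing.isLinear.Build _ _ _ _ g gL).
rewrite /perp memv_ker (lfunE gl); split=> [/eqP/colP g0 u uU|h].
  have minkDl w x : mink (w + x) v = mink w v + mink x v.
    by rewrite /mink raddfD /= !mulmxDl [LHS]mxE.
  have minkZl a w : mink (a *: w) v = a * mink w v.
    by rewrite /mink linearZ /= -!scalemxAl [LHS]mxE.
  rewrite (coord_vbasis uU); elim/big_rec: _ => [|i x _ x0].
    by rewrite -(scale0r 0) minkZl mul0r.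
  by rewrite minkDl minkZl x0 addr0; have := g0 i; rewrite !mxE => ->; rewrite mulr0.
apply/eqP/colP => i; rewrite !mxE; apply: h.
by apply: vbasis_mem; apply: mem_nth; rewrite size_tuple.
Qed.

Definition wedge (a b : V) : 'M[R]_6 := (b *m a^T - a *m b^T) *m gram42.

Lemma wedgeE (a b c : V) :
  wedge a b *m c = mink a c *: b - mink b c *: a.
Proof.
have h (x y : V) : y *m x^T *m gram42 *m c = mink x c *: y.
  by rewrite -!mulmxA [x^T *m _]mx11_scalar mul_mx_scalar mulmxA.
by rewrite /wedge !mulmxBl !h.
Qed.

Variable Sigma : surface R.

Section Subbundles.
Variable F : Sigma -> {vspace V}.

Definition section_on (U : set Sigma) (s : Sigma -> V) :=
  smooth_on U s /\ forall x, U x -> s x \in F x.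

Definition section_near (p : Sigma) (s : Sigma -> V) :=
  exists2 U, open_nbhs p U & section_on U s.

Definition subbundle (k : nat) := forall p, exists U (s : 'I_k -> Sigma -> V),
  [/\ open_nbhs p U, forall i, section_on U (s i) &
      forall x, U x -> basis_of (F x) [seq s i x | i <- enum 'I_k]].

Definition null_subbundle := forall p v, v \in F p -> mink v v = 0.

Definition isotropic := forall p u v, u \in F p -> v \in F p -> mink u v = 0.

Definition derived_bundle (p : Sigma) : set V :=
  lspan [set v | exists s, section_near p s /\
                   (v = s p \/ exists X, v = dd s p X)].

End Subbundles.

Section LegendreImmersions.
Variable f : Sigma -> {vspace V}.

Definition legendre_immersion :=
  [/\ subbundle f 2, isotropic f,
      forall p, derived_bundle f p = [set v | v \in perp (f p)] &
      forall p X, (forall s, section_near f p s -> dd s p X \in f p) -> X = 0].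

Definition curvature_along (p : Sigma) (L : {vspace V})
    (T : {vspace 'rV[R]_2}) :=
  forall X s, X \in T -> section_near f p s -> s p \in L -> dd s p X \in f p.

Definition curvature_sphere (p : Sigma) (L : {vspace V}) :=
  [/\ \dim L = 1%N, (L <= f p)%VS &
      exists2 T : {vspace 'rV[R]_2}, T != 0%VS & curvature_along p L T].

Definition curvature_space (p : Sigma) (L : {vspace V})
    (T : {vspace 'rV[R]_2}) :=
  curvature_along p L T /\ forall T', curvature_along p L T' -> (T' <= T)%VS.

Definition umbilic (p : Sigma) := exists! L, curvature_sphere p L.

Definition umbilic_free := forall p, ~ umbilic p.

End LegendreImmersions.

Section LieApplicable.
Variable f : Sigma -> {vspace V}.
Variable eta : Sigma -> {linear 'rV[R]_2 -> 'M[R]_6}.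

Definition valued_in_f_wedge_perp := forall p X,
  lspan [set A | exists a b, [/\ a \in f p, b \in perp (f p) & A = wedge a b]]
    (eta p X).

Definition bracket_form (p : Sigma) (X Y : 'rV[R]_2) : 'M[R]_6 :=
  (eta p X *m eta p Y - eta p Y *m eta p X) *+ 2.

(* [q p X Y] is the trace of the endomorphism s |-> eta(X) d_Y s of [f p],
   computed from its matrix [A] in a local frame of [f]. *)
Definition quadratic_differential
    (q : Sigma -> 'rV[R]_2 -> 'rV[R]_2 -> R) :=
  forall p X Y, exists (s : 'I_2 -> Sigma -> V) (A : 'M[R]_2),
    [/\ forall j, section_near f p (s j),
        basis_of (f p) [seq s j p | j <- enum 'I_2],
        forall j, eta p X *m dd (s j) p Y = \sum_k A k j *: s k p &
        q p X Y = \tr A].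

Definition lie_applicable_with (q : Sigma -> 'rV[R]_2 -> 'rV[R]_2 -> R) :=
  [/\ legendre_immersion f,
      [/\ smooth_form eta, valued_in_f_wedge_perp & closed_form eta],
      forall p X Y, bracket_form p X Y = 0,
      quadratic_differential q &
      exists p X Y, q p X Y != 0].

Definition parallel_subbundle (m : R) (F : Sigma -> {vspace V}) :=
  forall p s X, section_near F p s ->
    dd s p X + m *: (eta p X *m s p) \in F p.

Definition darboux_transform (m : R) (fhat : Sigma -> {vspace V}) :=
  m != 0 /\ exists shat : Sigma -> {vspace V},
    [/\ subbundle shat 1, null_subbundle shat, parallel_subbundle m shat,
        forall p L, curvature_sphere f p L -> ~ (L <= perp (shat p))%VS &
        forall p, fhat p = ((perp (shat p) :&: f p) + shat p)%VS].

End LieApplicable.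

Section IsothermicSphereCongruences.
Variable q : Sigma -> 'rV[R]_2 -> 'rV[R]_2 -> R.

Definition has_signature (b : 'rV[R]_2 -> 'rV[R]_2 -> R) (k l : nat) :=
  exists e : 'I_2 -> 'rV[R]_2,
    [/\ basis_of fullv [seq e i | i <- enum 'I_2],
        forall i j, i != j -> b (e i) (e j) = 0,
        #|[set i | 0 < b (e i) (e i)]%SET| = k &
        #|[set i | b (e i) (e i) < 0]%SET| = l].

Definition constant_signature := exists k l, forall p, has_signature (q p) k l.

(* Positive definite element of (T^* )^2, extended by zero along T'. *)
Definition pos_def_on (T T' : {vspace 'rV[R]_2})
    (b : 'rV[R]_2 -> 'rV[R]_2 -> R) :=
  [/\ forall X Y, b X Y = b Y X,
      forall a X Y Z, b (a *: X + Y) Z = a * b X Z + b Y Z,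
      forall X Y, X \in T' -> b X Y = 0 &
      forall X, X \in T -> X != 0 -> 0 < b X X].

Definition complexv (v : V) : 'cV[R[i]]_6 := map_mx (real_complex R) v.

Definition complexify (L : {vspace V}) : {vspace 'cV[R[i]]_6} :=
  <<[seq complexv v | v <- vbasis L]>>%VS.

(* The sign [(-1) ^+ neg] and the free choice of which curvature sphere
   congruence is called [s1] implement "up to the sign of q and the ordering
   of T1, T2".  The lifts are unique only up to sign and exist in general only
   locally, whence the open set [U]. *)
Definition isothermic_sphere_congruences (f : Sigma -> {vspace V})
    (U : set Sigma) (splus sminus : Sigma -> {vspace 'cV[R[i]]_6}) :=
  exists (s1 s2 : Sigma -> {vspace V}) (T1 T2 : Sigma -> {vspace 'rV[R]_2})
    (q1 q2 : Sigma -> 'rV[R]_2 -> 'rV[R]_2 -> R)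
    (sigma1 sigma2 : Sigma -> V) (eps : R[i]) (neg : bool),
  [/\ (forall x, U x ->
        [/\ curvature_sphere f x (s1 x), curvature_sphere f x (s2 x),
            s1 x != s2 x, curvature_space f x (s1 x) (T1 x) &
            curvature_space f x (s2 x) (T2 x)]),
      [\/ eps = 0, eps = 1 | eps = 'i],
      (forall x, U x ->
        [/\ pos_def_on (T1 x) (T2 x) (q1 x), pos_def_on (T2 x) (T1 x) (q2 x) &
            forall X Y, (q x X Y)%:C =
              (-1) ^+ neg * (- eps ^+ 2 * (q1 x X Y)%:C + (q2 x X Y)%:C)]),
      [/\ section_on s1 U sigma1, section_on s2 U sigma2,
          (forall x, U x -> sigma1 x != 0 /\ sigma2 x != 0),
          (forall x X Y, U x ->
             q2 x X Y = mink (dd sigma1 x X) (dd sigma1 x Y)) &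
          (if eps == 0
           then forall x Y, U x -> Y \in T2 x -> dd sigma2 x Y \in s1 x
           else forall x X Y, U x ->
             q1 x X Y = mink (dd sigma2 x X) (dd sigma2 x Y))] &
      forall x, U x ->
        splus x = <[complexv (sigma1 x) + eps *: complexv (sigma2 x)]>%VS /\
        sminus x = <[complexv (sigma1 x) - eps *: complexv (sigma2 x)]>%VS].

End IsothermicSphereCongruences.

End LieSphereGeometry.

(* Main.v *)
Require Import Defs.
From HB Require Import structures.
From mathcomp Require Import all_boot all_order all_algebra.
From mathcomp Require Import all_classical all_reals all_analysis.
From mathcomp Require Import complex.
From mathcomp Require Import zify ring lra.

Set Implicit Arguments.
Unset Strict Implicit.
Unset Printing Implicit Defensive.

Import Order.TTheory GRing.Theory Num.Theory.
Import numFieldNormedType.Exports.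

Local Open Scope classical_set_scope.
Local Open Scope ring_scope.

(** Let s1, s2 be lifts of the curvature spheres of f near p, let X1, X2 span
the curvature directions at p, and put u1 = d_X2 s1 and u2 = d_X1 s2.  As f is
Legendre, the class of u1, u2 is an orthogonal frame of the definite plane
f^perp / f (symmetry of second derivatives gives the orthogonality, see
[second_form_sym], and [null_perp_mem] the definiteness).

The form eta kills f and is closed, so eta(X) d_Y s is symmetric in X and Y for
every section s of f; hence eta(X1) u1 = 0 and eta(X2) u2 = 0, and eta is known
at p, modulo the second exterior power of f, from

  eta(X1) u2 = p1 s1 + r1 s2,   eta(X2) u1 = p2 s1 + r2 s2.

The numbers r1 = q(X1, X1) and p2 = q(X2, X2) are the two entries of the
quadratic differential, while p1 and r2 depend on the choice of eta in its gauge
orbit.  Differentiating the identity (eta(Y) u1, u2) = 0 and using closedness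
once more gives r2 |u2|^2 = - p1 |u1|^2 ([potential_relation]).  This relation
makes the gauge dependent terms cancel below.

Let H be a lift of the parallel line.  The line s0 is spanned by
S0 = a s1 + b s2 with a = (s2, H) and b = - (s1, H), both nonzero.  Modulo f we
have d_X1 S0 = b u2 and d_X2 S0 = a u1, and modulo the Darboux transform
d_Xi H = - m eta(Xi) H = - alpha_i d_Xi S0, where the number alpha_i is found by
pairing with u1 and u2.  Hence the curvature spheres of the Darboux transform at
p are the lines spanned by alpha_i S0 + H ([curvature_sphere_frame]), and p is
umbilic if and only if alpha_1 = alpha_2.  Clearing denominators, this reads

  p2 b^2 |u2|^2 + r1 a^2 |u1|^2 = 0      ([umbilic_darboux]).

The normalisation of q says that r1 = - (+-1) eps^2 |u2|^2 and
p2 = (+-1) |u1|^2, so the condition becomes b^2 = eps^2 a^2, that is, S0 is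
proportional to s1 + eps s2 or to s1 - eps s2.  If eps is 0 or i, neither side
of the equivalence can hold, since a and b are real and nonzero.

Only the values of a local section at p matter for its derivatives modulo the
bundle ([legendre_tensorial], [fhat_tensorial]); this is what allows the passage
from arbitrary sections in the definition of curvature spheres to the frames
above. *)

(** * Linear algebra *)

Lemma sum_ord2 (V : nmodType) (F : 'I_2 -> V) : \sum_i F i = F 0 + F 1.
Proof.
rewrite !big_ord_recl big_ord0 addr0; congr (_ + F _); exact/val_inj.
Qed.

Lemma mulmx_comb (R : comPzRingType) m n p (A : 'M[R]_(m, n)) a b (u v : 'M[R]_(n, p)) :
  A *m (a *: u + b *: v) = a *: (A *m u) + b *: (A *m v).
Proof. by rewrite mulmxDr -!scalemxAr. Qed.

Lemma col_mulmx (R : pzSemiRingType) m n p (A : 'M[R]_(m, n)) (B : 'M[R]_(n, p)) j :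
  col j (A *m B) = A *m col j B.
Proof. by apply/colP => i; rewrite !mxE; apply: eq_bigr => k _; rewrite mxE. Qed.

Lemma linear_comb2 (R : pzRingType) (U V : lmodType R) (h : {linear U -> V}) a b u v :
  h (a *: u + b *: v) = a *: h u + b *: h v.
Proof. by rewrite linearD !linearZ. Qed.

Lemma mem_sub_comb (K : fieldType) (vT : vectType K) (W : {vspace vT}) v x y :
  v - (x + y) \in W -> y \in W -> v - x \in W.
Proof. by move=> vW yW; have := memvD vW yW; rewrite opprD addrA addrNK. Qed.

Lemma free_ord_sum (K : fieldType) (vT : vectType K) n (v : 'I_n -> vT) (c : 'I_n -> K) :
  free [seq v i | i <- enum 'I_n] -> \sum_i c i *: v i = 0 -> forall i, c i = 0.
Proof.
move=> fv; have /freeP h : free [tuple v i | i < n] by [].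
move=> cv; apply: h; rewrite -[RHS]cv; apply: eq_bigr => i _.
by rewrite nth_mktuple.
Qed.

Lemma dim_frame2 (K : fieldType) (vT : vectType K) (W : {vspace vT}) (x y : vT) :
  x \in W -> y \in W -> (forall v, v \in W -> exists a b, v = a *: x + b *: y) ->
  (forall a b, a *: x + b *: y = 0 -> a = 0 /\ b = 0) -> \dim W = 2%N.
Proof.
move=> xW yW Wspan Wfree.
have WE : W = <<[:: x; y]>>%VS.
  apply/eqP; rewrite eqEsubv; apply/andP; split.
    apply/subvP => v /Wspan [a [b ->]].
    by rewrite memvD // memvZ // memv_span // !inE eqxx ?orbT.
  by apply/span_subvP => v; rewrite !inE => /orP[] /eqP->.
have fr : free [:: x; y].
  rewrite free_cons span_seq1 seq1_free; apply/andP; split.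
    apply/vlineP => -[k kE]; have := Wfree 1 (- k).
    by rewrite scale1r scaleNr kE subrr => -[] // /eqP; rewrite oner_eq0.
  apply/eqP => y0; have := Wfree 0 1.
  by rewrite y0 scaler0 scale0r add0r => -[] // _ /eqP; rewrite oner_eq0.
by rewrite WE (eqnP fr).
Qed.

Lemma frame2_span (K : fieldType) (vT : vectType K) (W : {vspace vT}) (u v : vT) :
  \dim W = 2%N -> u \in W -> v \in W ->
  (forall a b, a *: u + b *: v = 0 -> a = 0 /\ b = 0) ->
  forall w, w \in W -> exists a b, w = a *: u + b *: v.
Proof.
move=> dW uW vW uv w.
have -> : W = (<[u]> + <[v]>)%VS.
  apply/esym/eqP; rewrite eqEdim subv_add -!memvE uW vW dW /=.
  rewrite (@dim_frame2 _ _ _ u v) //.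
  - by rewrite memvE addvSl.
  - by rewrite memvE addvSr.
  by move=> _ /memv_addP [_ /vlineP[a ->] [_ /vlineP[b ->] ->]]; exists a, b.
by move=> /memv_addP [_ /vlineP[a ->] [_ /vlineP[b ->] ->]]; exists a, b.
Qed.

Lemma distinct_lines_free (K : fieldType) (vT : vectType K) (u v : vT) a b :
  u != 0 -> v != 0 -> <[u]>%VS != <[v]>%VS -> a *: u + b *: v = 0 -> a = 0 /\ b = 0.
Proof.
move=> u0 v0 uv E; have [a0|a0] := eqVneq a 0.
  split=> //; move: E; rewrite a0 scale0r add0r => /eqP.
  by rewrite scaler_eq0 (negPf v0) orbF => /eqP.
case/eqP: uv; apply/eqP; rewrite eqEdim -memvE !dim_vline u0 v0 andbT.
apply/vlineP; exists (- b / a); apply: (scalerI a0).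
by rewrite scalerA mulrC divfK // scaleNr; apply/eqP; rewrite -addr_eq0 E.
Qed.

(** The line is determined by the ratio of its two coordinates. *)
Lemma line_frame_eq (K : fieldType) (vT : vectType K) (u v : vT) (a b e : K) :
  (forall x y, x *: u + y *: v = 0 -> x = 0 /\ y = 0) -> a != 0 ->
  <[a *: u + b *: v]>%VS = <[u + e *: v]>%VS <-> b = e * a.
Proof.
move=> uv a0; split=> [E|->]; last first.
  rewrite mulrC -scalerA -scalerDr; apply/eqP; rewrite eqEsubv -!memvE.
  rewrite memvZ ?memv_line //=; apply/vlineP; exists a^-1.
  by rewrite scalerA mulVf // scale1r.
have : a *: u + b *: v \in <[u + e *: v]>%VS by rewrite -E memv_line.
move=> /vlineP[k /eqP]; rewrite scalerDr scalerA -subr_eq0 opprD addrACA -!scalerBl.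
by move=> /eqP/uv [/subr0_eq -> /subr0_eq ->]; rewrite mulrC.
Qed.

(** The trace of an endomorphism does not depend on the frame: here [S] and [E] hold
two frames of a plane as columns and [P] is the change of frame. *)
Lemma trace_frame (R : realType) (n : nat) (E S : 'M[R]_(n.+1, 2)) (M A : 'M[R]_2)
    (P : 'M[R]_2) :
  (forall c : 'cV[R]_2, E *m c = 0 -> c = 0) -> (forall c : 'cV[R]_2, S *m c = 0 -> c = 0) ->
  S = E *m P -> E *m (M *m P) = S *m A -> \tr A = \tr M.
Proof.
move=> Einj Sinj SE EA; have injE (B C : 'M[R]_2) : E *m B = E *m C -> B = C.
  move=> BC; apply/matrixP => i j; apply/eqP; rewrite -subr_eq0; apply/eqP.
  have /Einj /colP/(_ i) : E *m col j (B - C) = 0.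
    by rewrite -col_mulmx mulmxBr BC subrr; apply/colP => k; rewrite !mxE.
  by rewrite !mxE.
have PU : P \in unitmx.
  rewrite -unitmx_tr -row_free_unit; apply/inj_row_free => v vP.
  apply: trmx_inj; rewrite trmx0; apply: Sinj; rewrite SE -mulmxA.
  by rewrite -[P]trmxK -trmx_mul vP trmx0 mulmx0.
have MP : M *m P = P *m A by apply: injE; rewrite EA SE mulmxA.
have -> : A = invmx P *m (M *m P) by rewrite MP mulKmx.
by rewrite mxtrace_mulC mulmxK.
Qed.

(** * The bilinear form of signature (4,2) *)

Section LorentzAlgebra.
Variable R : realType.
Local Notation V := 'cV[R]_6.
Implicit Types (u v w : V) (U : {vspace V}).

Lemma minkE u v :
  mink u v = \sum_(i < 6) (if (i < 4)%N then 1 else -1) * (u i 0 * v i 0).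
Proof.
rewrite /mink mxE; apply: eq_bigr => i _.
by rewrite mul_mx_diag !mxE mulrCA mulrA mulrC.
Qed.

Lemma minkC u v : mink u v = mink v u.
Proof. by rewrite !minkE; apply: eq_bigr => i _; rewrite [u i 0 * _]mulrC. Qed.

Lemma minkDr u v w : mink u (v + w) = mink u v + mink u w.
Proof. by rewrite /mink mulmxDr [LHS]mxE. Qed.

Lemma minkDl u v w : mink (u + v) w = mink u w + mink v w.
Proof. by rewrite minkC minkDr !(minkC w). Qed.

Lemma minkZr a u v : mink u (a *: v) = a * mink u v.
Proof. by rewrite /mink -scalemxAr [LHS]mxE. Qed.

Lemma minkZl a u v : mink (a *: u) v = a * mink u v.
Proof. by rewrite minkC minkZr minkC. Qed.

Lemma minkNr u v : mink u (- v) = - mink u v.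
Proof. by rewrite -scaleN1r minkZr mulN1r. Qed.

Lemma minkNl u v : mink (- u) v = - mink u v.
Proof. by rewrite minkC minkNr minkC. Qed.

Lemma mink0r u : mink u 0 = 0.
Proof. by rewrite -(scale0r 0) minkZr mul0r. Qed.

Lemma mink0l u : mink 0 u = 0.
Proof. by rewrite minkC mink0r. Qed.

Definition minkl := (minkDl, minkZl, minkNl, mink0l, minkDr, minkZr, minkNr, mink0r).

Lemma mink_wedge a b u v : mink (wedge a b *m u) v = - mink u (wedge a b *m v).
Proof. by rewrite !wedgeE !minkl !(minkC u); ring. Qed.

Lemma mink_nondegenerate u : (forall v, mink u v = 0) -> u = 0.
Proof.
move=> u0; apply/colP => i; rewrite mxE.
have := u0 (delta_mx i 0); rewrite minkE (bigD1 i) //= big1 => [|j ji].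
  by rewrite !mxE !eqxx mulr1 addr0; case: ifP => _; rewrite ?mul1r ?mulN1r // => /eqP;
    rewrite oppr_eq0 => /eqP.
by rewrite mxE (negPf ji) !mulr0.
Qed.

Lemma dim_perp U : (\dim (perp U) + \dim U = 6)%N.
Proof.
pose g v := \col_(i < \dim U) mink (vbasis U)`_i v.
have gL : linear g by move=> a x y; apply/colP => i; rewrite !mxE !minkl.
pose gl := HB.pack_for {linear V -> 'cV[R]_(\dim U)} g
  (GRing.isLinear.Build _ _ _ _ g gL).
pose B : 'M[R]_(\dim U, 6) := \matrix_(i, j) (vbasis U)`_i j 0.
have Bfree : row_free (B *m gram42 R).
  apply/inj_row_free => c; rewrite mulmxA => cBG.
  have : \sum_i c 0 i *: (vbasis U)`_i = 0.
    apply: mink_nondegenerate => v; rewrite /mink.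
    have -> : (\sum_i c 0 i *: (vbasis U)`_i)^T = c *m B.
      by apply/rowP => j; rewrite !mxE summxE; apply: eq_bigr => i _; rewrite !mxE.
    by rewrite cBG mul0mx mxE.
  have /freeP h := basis_free (vbasisP U).
  by move/(h (fun i => c 0 i)) => c0; apply/rowP => i; rewrite c0 mxE.
have glE v : g v = (B *m gram42 R) *m v.
  apply/colP => i; rewrite mxE.
  have -> : (B *m gram42 R *m v) i 0 = row i (B *m gram42 R *m v) 0 0.
    by rewrite [RHS]mxE.
  rewrite !row_mul /mink; congr ((_ *m _ *m _) 0 0).
  by apply/rowP => j; rewrite !mxE.
have imE : limg (linfun gl) = fullv.
  apply/eqP; rewrite eqEsubv subvf /=; apply/subvP => w _.
  apply/memv_imgP; exists (pinvmx (B *m gram42 R) *m w); rewrite ?memvf //.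
  by rewrite (lfunE gl) /= glE mulmxA mulmxVp // mul1mx.
have dimc n : \dim {:'cV[R]_n} = n by rewrite dimvf /dim /= muln1.
by have := limg_ker_dim (linfun gl) fullv; rewrite capfv imE !dimc.
Qed.

Lemma perpP U v : reflect (forall u, u \in U -> mink u v = 0) (v \in perp U).
Proof. by apply: (iffP idP) => /memv_perp. Qed.

Lemma perpK U : perp (perp U) = U.
Proof.
apply/esym/eqP; rewrite eqEdim; apply/andP; split.
  by apply/subvP => u uU; apply/perpP => v /perpP/(_ u uU); rewrite minkC.
by have := dim_perp U; have := dim_perp (perp U); lia.
Qed.

(** The form is positive definite on the kernel of the projection to the last two
coordinates, so such a subspace projects injectively. *)
Lemma nonpos_dim U : (forall u, u \in U -> mink u u <= 0) -> (\dim U <= 2)%N.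
Proof.
move=> Un; pose g (v : V) : 'cV[R]_2 := \col_i v (rshift 4 i) 0.
have gL : linear g by move=> a x y; apply/colP => i; rewrite !mxE.
pose gl := HB.pack_for {linear V -> 'cV[R]_2} g
  (GRing.isLinear.Build _ _ _ _ g gL).
have := limg_ker_dim (linfun gl) U.
have -> : (U :&: lker (linfun gl) = 0)%VS.
  apply/eqP; rewrite -subv0; apply/subvP => v.
  rewrite memv_cap memv_ker (lfunE gl) /= => /andP[vU /eqP/colP g0].
  rewrite memv0; apply/eqP/colP => i; rewrite mxE.
  have := Un v vU.
  have -> : mink v v = \sum_(i < 6) v i 0 ^+ 2.
    rewrite minkE; apply: eq_bigr => j _; case: ifP => j4; first by rewrite mul1r expr2.
    have jE : (j - 4 < 2)%N by rewrite ltn_subLR // leqNgt j4.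
    have -> : j = rshift 4 (Ordinal jE) by apply: val_inj => /=; rewrite subnKC // leqNgt j4.
    by have := g0 (Ordinal jE); rewrite !mxE => ->; rewrite mulr0 mulr0 expr0n.
  move=> s0; have /eqP := le_anti (introT andP (conj s0 (sumr_ge0 _ (fun i _ => sqr_ge0 (v i 0))))).
  rewrite psumr_eq0 => [/allP/(_ i)|j _]; last exact: sqr_ge0.
  by rewrite mem_index_enum /= sqrf_eq0 => /(_ isT)/eqP.
rewrite dimv0 add0n => <-; rewrite (leq_trans (dimvS (subvf _))) //.
by rewrite dimvf /dim /= muln1.
Qed.

(** The form induced on the quotient of the orthogonal space of a maximal isotropic
plane is definite: otherwise the plane and [v] would span an isotropic subspace of
dimension 3. *)
Lemma null_perp_mem U v : (forall u w, u \in U -> w \in U -> mink u w = 0) ->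
  \dim U = 2%N -> v \in perp U -> mink v v = 0 -> v \in U.
Proof.
move=> Ui Ud /perpP vU v0.
have : (\dim (U + <[v]>) <= 2)%N.
  apply: nonpos_dim => _ /memv_addP[u uU [_ /vlineP[a ->] ->]].
  by rewrite !minkl (Ui u u) // (minkC v u) (vU u) // v0 !(mulr0, addr0).
move=> d.
have /eqP -> : U == (U + <[v]>)%VS by rewrite eqEdim addvSl Ud.
by rewrite memvE addvSr.
Qed.

(** By dimension, [U], [u1] and [u2] span [perp U], and [perp] is an involution. *)
Lemma orthogonal_frame_mem U u1 u2 w :
  (forall u w, u \in U -> w \in U -> mink u w = 0) -> \dim U = 2%N ->
  u1 \in perp U -> u2 \in perp U -> mink u1 u1 != 0 -> mink u2 u2 != 0 ->
  mink u1 u2 = 0 -> w \in perp U -> mink u1 w = 0 -> mink u2 w = 0 -> w \in U.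
Proof.
move=> Ui Ud u1U u2U n1 n2 u12 wU w1 w2.
have UU : (U <= perp U)%VS by apply/subvP => u uU; apply/perpP => v vU; exact: Ui.
have addl (W : {vspace V}) u : u \notin W -> (\dim W < \dim (W + <[u]>))%N.
  move=> uW; rewrite ltn_neqAle dimvS ?addvSl // andbT; apply: contra uW => /eqP d.
  have /eqP -> : W == (W + <[u]>)%VS by rewrite eqEdim addvSl d leqnn.
  by rewrite memvE addvSr.
pose Q := (U + <[u1]> + <[u2]>)%VS.
have QU : Q = perp U.
  apply/eqP; rewrite eqEdim !subv_add UU -!memvE u1U u2U /=.
  have d1 : (\dim U < \dim (U + <[u1]>))%N.
    by apply: addl; apply: contra n1 => u1f; rewrite Ui.
  have d2 : (\dim (U + <[u1]>) < \dim Q)%N.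
    apply: addl; apply: contra n2 => /memv_addP[u uU [_ /vlineP[a ->] E]].
    rewrite {2}E !minkl minkC (minkC _ u1) u12 mulr0 addr0.
    by move/perpP: u2U => ->.
  by have := dim_perp U; lia.
rewrite -[U]perpK -QU; apply/perpP => _
  /memv_addP[_ /memv_addP[u uU [_ /vlineP[a ->] ->]] [_ /vlineP[b ->] ->]].
by rewrite !minkl w1 w2 !(mulr0, addr0); move/perpP: wU => ->.
Qed.

Lemma orthogonal_comb0 (v w : V) x y :
  mink v v != 0 -> mink w w != 0 -> mink v w = 0 ->
  mink (x *: v + y *: w) v = 0 -> mink (x *: v + y *: w) w = 0 -> x = 0 /\ y = 0.
Proof.
move=> v0 w0 vw; rewrite !minkDl !minkZl (minkC w v) vw !mulr0 addr0 add0r.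
by move=> /eqP + /eqP; rewrite !mulf_eq0 (negPf v0) (negPf w0) !orbF => /eqP -> /eqP ->.
Qed.

(** The orthogonal space does not see components in [W]. *)
Lemma mink_mod (W : {vspace V}) k u v w :
  v - k *: u \in W -> w \in perp W -> mink v w = k * mink u w.
Proof.
by move=> vW /perpP wW; rewrite -[v](subrK (k *: u)) minkDl wW // add0r minkZl.
Qed.

Lemma mink_mod2 (W : {vspace V}) k k' u u' v v' :
  v - k *: u \in W -> v' - k' *: u' \in W -> v' \in perp W -> u \in perp W ->
  mink v v' = k * k' * mink u' u.
Proof.
move=> vW vW' v'W uW; rewrite (mink_mod vW v'W) minkC (mink_mod vW' uW).
exact: mulrA.
Qed.

End LorentzAlgebra.

(** * Derivatives of matrix-valued maps *)

(** Differentiability is a local property: a function that vanishes near a point has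
the zero map as differential there. *)
Lemma near_eq_differentiable (R : realType) (V W : normedModType R) (g h : V -> W) (x : V) :
  (\near x, g x = h x) -> differentiable g x -> differentiable h x.
Proof.
move=> gh dg.
have -> : h = g + (h - g) by rewrite addrC subrK.
apply: differentiableD => //.
have gx : (h - g) x = 0 by have := nbhs_singleton gh => /= E; rewrite !fctE E subrr.
have E : (h - g) \o shift x = cst ((h - g) x) + \0 +o_ 0 id.
  apply/eqaddoE; rewrite addr0 funeqE => y /=; rewrite gx add0r.
  rewrite littleoE // => _/posnumP[e].
  have : \near x, (h - g) x = 0.
    by near=> z; rewrite !fctE -(near gh z) ?subrr.
  rewrite (near_shift 0 x) subr0 /= => gn; near=> z.
  by rewrite (near gn z) // normr0 mulr_ge0.
have c0 : continuous (\0 : V -> W) by exact: cst_continuous.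
by apply/diff_locallyP; rewrite (diff_unique c0 E).
Unshelve. all: by end_near. Qed.

Section Calculus.
Variable R : realType.

Lemma differentiable_mxP (V : normedModType R) m n
    (M : V -> 'M[R]_(m.+1, n.+1)) (x : V) :
  (forall i j, differentiable (fun y => M y i j) x) -> differentiable M x.
Proof.
move=> dM.
have -> : M = \sum_i \sum_j (fun y => M y i j *: delta_mx i j).
  apply/funext => y; rewrite [LHS]matrix_sum_delta fct_sumE.
  by apply: eq_bigr => i _; rewrite fct_sumE.
apply: differentiable_sum => i; apply: differentiable_sum => j.
exact: differentiableZl.
Qed.

Lemma differentiable_entry (V : normedModType R) m n
    (M : V -> 'M[R]_(m.+1, n.+1)) (x : V) i j :
  differentiable M x -> differentiable (fun y => M y i j) x.
Proof.
move=> dM; apply: (@differentiable_comp _ _ _ _ M (fun N => N i j)) => //.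
exact: differentiable_coord.
Qed.

Lemma derive_entry (V : normedModType R) m n
    (M : V -> 'M[R]_(m.+1, n.+1)) (x v : V) i j :
  differentiable M x -> ('D_v M x) i j = 'D_v (fun y => M y i j) x.
Proof.
move=> dM; rewrite derive_mx; last exact/diff_derivable.
exact: (etrans (mxE _ _ _ _)).
Qed.

Lemma differentiable_mulmx (V : normedModType R) m n p
    (A : V -> 'M[R]_(m.+1, n.+1)) (B : V -> 'M[R]_(n.+1, p.+1)) (x : V) :
  differentiable A x -> differentiable B x ->
  differentiable (fun y => A y *m B y) x.
Proof.
move=> dA dB; apply: differentiable_mxP => i j.
have -> : (fun y => (A y *m B y) i j) =
  \sum_k ((fun y => A y i k) * (fun y => B y k j)).
  by apply/funext => y; rewrite mxE fct_sumE.
apply: differentiable_sum => k.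
by apply: differentiableM; exact: differentiable_entry.
Qed.

Lemma derive_mulmx (V : normedModType R) m n p
    (A : V -> 'M[R]_(m.+1, n.+1)) (B : V -> 'M[R]_(n.+1, p.+1)) (x v : V) :
  differentiable A x -> differentiable B x ->
  'D_v (fun y => A y *m B y) x = 'D_v A x *m B x + A x *m 'D_v B x.
Proof.
move=> dA dB.
have dAe i k : derivable (fun y => A y i k) x v.
  by apply: diff_derivable; exact: differentiable_entry.
have dBe i k : derivable (fun y => B y i k) x v.
  by apply: diff_derivable; exact: differentiable_entry.
rewrite !derive_mx; try apply: diff_derivable => //; last first.
  exact: differentiable_mulmx.
apply/matrixP => i j; rewrite !mxE -big_split /=.
have -> : (fun y => (A y *m B y) i j) =
  \sum_k ((fun y => A y i k) * (fun y => B y k j)).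
  by apply/funext => y; rewrite mxE fct_sumE.
rewrite derive_sum => [|k]; last exact: derivableM.
apply: eq_bigr => k _; rewrite deriveM //= !mxE addrC; congr (_ + _).
by rewrite -[LHS]/(_ * _) mulrC.
Qed.

Lemma differentiable_trmx (V : normedModType R) m n
    (A : V -> 'M[R]_(m.+1, n.+1)) (x : V) :
  differentiable A x -> differentiable (fun y => (A y)^T) x.
Proof.
move=> dA; apply: differentiable_mxP => i j.
have -> : (fun y => (A y)^T i j) = (fun y => A y j i).
  by apply/funext => y; rewrite mxE.
exact: differentiable_entry.
Qed.

Lemma derive_trmx (V : normedModType R) m n
    (A : V -> 'M[R]_(m.+1, n.+1)) (x v : V) :
  differentiable A x -> 'D_v (fun y => (A y)^T) x = ('D_v A x)^T.
Proof.
move=> dA; rewrite !derive_mx; try apply: diff_derivable => //; last first.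
  exact: differentiable_trmx.
apply/matrixP => i j; rewrite !mxE; congr ('D_v _ x).
by apply/funext => y; rewrite mxE.
Qed.

End Calculus.

(** * Smooth maps on open subsets of the plane *)

Section SmoothMaps.
Variable R : realType.
Implicit Types (W : normedModType R) (U : set 'rV[R]_2).

Lemma derive_coord W (g : 'rV[R]_2 -> W) x X : differentiable g x ->
  'D_X g x = X 0 0 *: 'D_(delta_mx 0 0) g x + X 0 1 *: 'D_(delta_mx 0 1) g x.
Proof.
move=> dg; rewrite deriveE // {1}[X]row_sum_delta linear_sum.
rewrite !big_ord_recl big_ord0 addr0 !linearZ /= !deriveE //.
by have -> : lift ord0 ord0 = 1 :> 'I_2 by exact/val_inj.
Qed.

Lemma open_near U (P : 'rV[R]_2 -> Prop) x : open U -> U x ->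
  (forall y, U y -> P y) -> \near x, P x.
Proof. by move=> oU Ux UP; apply: filterS UP _; exact: open_nbhs_nbhs. Qed.

(** On an open set, only the values on this set matter. *)
Lemma Ck_ext W k U (g h : 'rV[R]_2 -> W) : open U ->
  (forall x, U x -> g x = h x) -> Ck k U g -> Ck k U h.
Proof.
move=> oU; elim: k g h => [|k IH] g h gh /=.
  move=> cg x Ux; have := cg x Ux; rewrite /prop_for /continuous_at gh //.
  by apply: cvg_trans; apply: (@near_eq_cvg _ _ (nbhs x)); exact: (open_near oU Ux gh).
case=> dg cg; split=> [x Ux|i].
  exact: near_eq_differentiable (open_near oU Ux gh) (dg x Ux).
apply: IH (cg i) => x Ux; apply: near_eq_derive.
exact: (open_near oU Ux gh).
Qed.

Lemma Ck_le W k U (g : 'rV[R]_2 -> W) : Ck k.+1 U g -> Ck k U g.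
Proof.
elim: k g => [|k IH] g [dg cg]; first by move=> x Ux; exact/differentiable_continuous/dg.
by split=> // i; apply: IH.
Qed.

Lemma Ck_sub W k U U' (g : 'rV[R]_2 -> W) : U' `<=` U -> Ck k U g -> Ck k U' g.
Proof.
move=> UU; elim: k g => [|k IH] g /=; first by move=> cg x /UU; exact: cg.
by case=> dg cg; split=> [x /UU/dg//|i]; exact: IH.
Qed.

Lemma CkD W k U (g h : 'rV[R]_2 -> W) : open U ->
  Ck k U g -> Ck k U h -> Ck k U (g + h).
Proof.
move=> oU; elim: k g h => [|k IH] g h /=.
  by move=> cg ch x Ux; exact: (cvgD (cg x Ux) (ch x Ux)).
move=> [dg cg] [dh ch]; split=> [x Ux|i].
  by apply: differentiableD; [exact: dg|exact: dh].
apply: Ck_ext (IH _ _ (cg i) (ch i)) => // x Ux.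
by rewrite deriveD //; apply: diff_derivable; [exact: dg|exact: dh].
Qed.

Lemma CkZ W k U a (g : 'rV[R]_2 -> W) : open U -> Ck k U g -> Ck k U (a *: g).
Proof.
move=> oU; elim: k g => [|k IH] g /=.
  by move=> cg x Ux; exact: (cvgZl_tmp (cg x Ux)).
move=> [dg cg]; split=> [x Ux|i]; first exact/differentiableZ/dg.
apply: Ck_ext (IH _ (cg i)) => // x Ux.
by rewrite deriveZ //; apply: diff_derivable; exact: dg.
Qed.

Lemma Ck_derive W k U X (g : 'rV[R]_2 -> W) : open U ->
  Ck k.+1 U g -> Ck k U ('D_X g).
Proof.
move=> oU [dg cg]; apply: (@Ck_ext _ _ _ (X 0 0 *: 'D_(delta_mx 0 0) g +
  X 0 1 *: 'D_(delta_mx 0 1) g)) => // [x Ux|]; last first.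
  exact: (CkD oU (CkZ _ oU (cg _)) (CkZ _ oU (cg _))).
by rewrite (derive_coord X (dg x Ux)).
Qed.

(** The loss of one order of smoothness is harmless for smooth maps, and it lets the
base case follow from differentiability instead of a separate continuity proof. *)
Lemma Ck_mulmx k U m n p (A : 'rV[R]_2 -> 'M[R]_(m.+1, n.+1))
    (B : 'rV[R]_2 -> 'M[R]_(n.+1, p.+1)) : open U ->
  Ck k.+1 U A -> Ck k.+1 U B -> Ck k U (fun x => A x *m B x).
Proof.
move=> oU; elim: k A B => [|k IH] A B CA CB; have [dA cA] := CA; have [dB cB] := CB.
  move=> x Ux; apply/differentiable_continuous/differentiable_mulmx;
  [exact: dA|exact: dB].
split=> [x Ux|i]; first by apply: differentiable_mulmx; [exact: dA|exact: dB].
apply: Ck_ext (CkD oU (IH _ _ (cA i) (Ck_le CB)) (IH _ _ (Ck_le CA) (cB i))) => // x Ux.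
by rewrite derive_mulmx //; [exact: dA|exact: dB].
Qed.

Lemma Ck_trmx k U m n (A : 'rV[R]_2 -> 'M[R]_(m.+1, n.+1)) : open U ->
  Ck k.+1 U A -> Ck k U (fun x => (A x)^T).
Proof.
move=> oU; elim: k A => [|k IH] A CA; have [dA cA] := CA.
  by move=> x Ux; apply/differentiable_continuous/differentiable_trmx/dA.
split=> [x Ux|i]; first exact/differentiable_trmx/dA.
by apply: Ck_ext (IH _ (cA i)) => // x Ux; rewrite derive_trmx //; exact: dA.
Qed.

Lemma is_derive_line W (g : 'rV[R]_2 -> W) z X (t : R) :
  differentiable g (z + t *: X) ->
  is_derive t 1 (fun s : R => g (z + s *: X)) ('D_X g (z + t *: X)).
Proof.
move=> dg.
have E : (fun h : R => h^-1 *: (((fun s : R => g (z + s *: X)) \o shift t)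
       (h *: 1) - g (z + t *: X))) =
   (fun h => h^-1 *: ((g \o shift (z + t *: X)) (h *: X) - g (z + t *: X))).
  apply/funext => h /=; congr (_ *: (g _ - _)).
  by rewrite -[h *: 1]/(h * 1) mulr1 scalerDl addrCA.
by split; [rewrite /derivable E; exact: diff_derivable | rewrite /derive E].
Qed.

End SmoothMaps.

(** * Symmetry of second derivatives *)

Section Schwarz.
Variable R : realType.

(** The mean value theorem applied twice: first along [X] to the difference of two
translates of [g], then along [Y] to ['D_X g]. *)
Lemma second_difference (U : set 'rV[R]_2) (g : 'rV[R]_2 -> R) x X Y (h : R) :
  open U -> 0 < h -> Ck 2 U g ->
  (forall s t, 0 <= s <= h -> 0 <= t <= h -> U (x + s *: X + t *: Y)) ->
  exists s t, [/\ 0 <= s <= h, 0 <= t <= h &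
    g (x + h *: X + h *: Y) - g (x + h *: X) - (g (x + h *: Y) - g x) =
    'D_Y ('D_X g) (x + s *: X + t *: Y) * h * h].
Proof.
move=> oU h0 Cg hU; have [dg _] := Cg.
have cinc (c : R) : c \in `[0, h] -> 0 <= c <= h by rewrite in_itv.
have inc (c : R) : c \in `]0, h[ -> 0 <= c <= h.
  by rewrite in_itv /= => /andP[/ltW-> /ltW->].
have h00 : 0 <= (0 : R) <= h by rewrite lexx ltW.
have hh : 0 <= h <= h by rewrite lexx ltW.
have C1 : Ck 1 U ('D_X g) by exact: Ck_derive.
have [dDg _] := C1.
pose F s := g (x + s *: X + h *: Y) - g (x + s *: X).
have dF s : 0 <= s <= h -> is_derive s (1 : R) F
    ('D_X g (x + s *: X + h *: Y) - 'D_X g (x + s *: X)).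
  move=> sh; apply: is_deriveB; last first.
    by apply: is_derive_line; apply: dg; have := hU _ _ sh h00; rewrite scale0r addr0.
  have := @is_derive_line R _ g (x + h *: Y) X s.
  rewrite [x + _ + _ *: X]addrAC => H.
  have := H (dg _ (hU _ _ sh hh)).
  by under [fun s : R => _]funext => z do rewrite addrAC.
have cF : {within `[0, h], continuous F}.
  apply: derivable_within_continuous => s /cinc sh; exact: (@ex_derive _ _ _ _ _ _ _ (dF s sh)).
have [s /inc sh] := MVT h0 (fun s sh => dF s (inc s sh)) cF.
rewrite /F scale0r addr0 => ->.
pose G t := 'D_X g (x + s *: X + t *: Y).
have dG t : 0 <= t <= h -> is_derive t (1 : R) G ('D_Y ('D_X g) (x + s *: X + t *: Y)).
  by move=> th; apply: is_derive_line; apply: dDg; exact: hU.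
have cG : {within `[0, h], continuous G}.
  apply: derivable_within_continuous => t /cinc th; exact: (@ex_derive _ _ _ _ _ _ _ (dG t th)).
have [t /inc th] := MVT h0 (fun t th => dG t (inc t th)) cG.
rewrite /G scale0r addr0 subr0 => ->.
by exists s, t.
Qed.

(** The second difference over a small parallelogram is symmetric in the two sides;
[second_difference] compares it with both mixed derivatives at nearby points, and these
are continuous. *)
Lemma schwarz_scalar (U : set 'rV[R]_2) (g : 'rV[R]_2 -> R) x X Y :
  open U -> U x -> Ck 2 U g -> 'D_X ('D_Y g) x = 'D_Y ('D_X g) x.
Proof.
have close (e a b c d : R) : `|b - d| < e / 2 -> `|a - c| < e / 2 -> d = c ->
    `|a - b| <= e.
  move=> bd ac dc; rewrite dc distrC in bd; rewrite (splitr e) ltW //.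
  exact: le_lt_trans (ler_distD c _ _) (ltrD ac bd).
move=> oU Ux Cg; apply/eqP; rewrite -subr_eq0 -normr_le0; apply/ler_addgt0Pr => e e0.
rewrite add0r.
have N Z Z' : \forall y \near x, `|'D_Z ('D_Z' g) x - 'D_Z ('D_Z' g) y| < e / 2.
  have CZ : Ck 0 U ('D_Z ('D_Z' g)) by do 2 apply: Ck_derive => //.
  by have /cvgrPdist_lt := CZ x Ux; apply; rewrite divr_gt0.
have : nbhs x (U `&` (fun y => `|'D_X ('D_Y g) x - 'D_X ('D_Y g) y| < e / 2) `&`
    (fun y => `|'D_Y ('D_X g) x - 'D_Y ('D_X g) y| < e / 2)).
  exact: filterI (filterI (open_nbhs_nbhs (conj oU Ux)) (N X Y)) (N Y X).
rewrite -nbhs_ballE => -[r /= r0 Hr].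
(* small enough for the parallelogram at [x] to lie in the ball of radius [r] *)
pose h := r / (`|X| + `|Y| + 1).
have d0 : 0 < `|X| + `|Y| + 1 by rewrite ltr_wpDl // addr_ge0.
have h0 : 0 < h by rewrite divr_gt0.
have hr s t Z Z' : 0 <= s <= h -> 0 <= t <= h -> `|Z| + `|Z'| = `|X| + `|Y| ->
    ball x r (x + s *: Z + t *: Z').
  move=> /andP[s0 sh] /andP[t0 th] E; rewrite -ball_normE /ball_ /=.
  rewrite -addrA opprD addNKr normrN (le_lt_trans (ler_normD _ _)) //.
  rewrite !normrZ !ger0_norm // (@le_lt_trans _ _ (h * (`|Z| + `|Z'|))) //.
    by rewrite mulrDr lerD // ler_wpM2r.
  by rewrite E /h mulrAC ltr_pdivrMr // ltr_pM2l // ltrDl.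
have [s [t [sh th E1]]] := @second_difference U g x X Y h oU h0 Cg
  (fun s t sh th => (Hr _ (hr s t X Y sh th erefl)).1.1).
have [s' [t' [sh' th' E2]]] := @second_difference U g x Y X h oU h0 Cg
  (fun s t sh th => (Hr _ (hr s t Y X sh th (addrC _ _))).1.1).
have [_ B1] := Hr _ (hr s t X Y sh th erefl).
have [[_ B2] _] := Hr _ (hr s' t' Y X sh' th' (addrC _ _)).
have E3 : 'D_Y ('D_X g) (x + s *: X + t *: Y) =
          'D_X ('D_Y g) (x + s' *: Y + t' *: X).
  apply: (mulIf (lt0r_neq0 h0)); apply: (mulIf (lt0r_neq0 h0)).
  have sw (P a b c : R) : P - a - (b - c) = P - b - (a - c) by ring.
  apply: etrans (esym E1) _; apply: etrans E2.
  by rewrite [x + _ + h *: Y]addrAC; exact: sw.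
exact: close B1 B2 E3.
Qed.

Lemma schwarz (U : set 'rV[R]_2) n (g : 'rV[R]_2 -> 'cV[R]_n.+1) x X Y :
  open U -> U x -> Ck 2 U g -> 'D_X ('D_Y g) x = 'D_Y ('D_X g) x.
Proof.
move=> oU Ux Cg; apply/matrixP => i j.
have Ce k (h : 'rV[R]_2 -> 'cV[R]_n.+1) : Ck k U h -> Ck k U (fun x => h x i j).
  elim: k h => [|k IH] h /=.
    move=> ch y Uy; apply: (@continuous_comp _ _ _ h (fun M : 'cV[R]_n.+1 => M i j)).
      exact: ch.
    exact: coord_continuous.
  move=> [dh ch]; split=> [y Uy|l]; first exact/differentiable_entry/dh.
  apply: Ck_ext (IH _ (ch l)) => // y Uy /=.
  by rewrite derive_entry //; exact: dh.
have DE Y1 Z : ('D_Z ('D_Y1 g) x) i j = 'D_Z ('D_Y1 (fun y => g y i j)) x.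
  have [dYg _] : Ck 1 U ('D_Y1 g) by exact: Ck_derive.
  rewrite derive_entry; last exact: dYg.
  apply: near_eq_derive; apply: (open_near oU Ux) => y Uy; have [dg _] := Cg.
  by apply: derive_entry; exact: dg.
apply: etrans (DE _ _) (etrans _ (esym (DE _ _))).
exact: (schwarz_scalar _ _ oU Ux (Ce _ _ Cg)).
Qed.

End Schwarz.

(** * Differentiating algebraic identities *)

Section CinftyMaps.
Variable R : realType.
Implicit Types (W : normedModType R) (O : set 'rV[R]_2).

Lemma Cinfty_differentiable W O (g : 'rV[R]_2 -> W) x :
  Cinfty O g -> O x -> differentiable g x.
Proof. by move=> /(_ 1) [dg _]; exact: dg. Qed.

Lemma Cinfty_derive W O (g : 'rV[R]_2 -> W) X :
  open O -> Cinfty O g -> Cinfty O ('D_X g).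
Proof. by move=> oO Cg k; exact: Ck_derive. Qed.

Lemma Cinfty_sub W O O' (g : 'rV[R]_2 -> W) :
  O' `<=` O -> Cinfty O g -> Cinfty O' g.
Proof. by move=> OO Cg k; exact: Ck_sub OO (Cg k). Qed.

Lemma CinftyD W O (g h : 'rV[R]_2 -> W) :
  open O -> Cinfty O g -> Cinfty O h -> Cinfty O (g + h).
Proof. by move=> oO Cg Ch k; exact: CkD. Qed.

Lemma CinftyZ W O a (g : 'rV[R]_2 -> W) :
  open O -> Cinfty O g -> Cinfty O (a *: g).
Proof. by move=> oO Cg k; exact: CkZ. Qed.

Lemma Cinfty_mulmx O m n p (A : 'rV[R]_2 -> 'M[R]_(m.+1, n.+1))
    (B : 'rV[R]_2 -> 'M[R]_(n.+1, p.+1)) :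
  open O -> Cinfty O A -> Cinfty O B -> Cinfty O (fun x => A x *m B x).
Proof. by move=> oO CA CB k; exact: Ck_mulmx. Qed.

Lemma Cinfty_trmx O m n (A : 'rV[R]_2 -> 'M[R]_(m.+1, n.+1)) :
  open O -> Cinfty O A -> Cinfty O (fun x => (A x)^T).
Proof. by move=> oO CA k; exact: Ck_trmx. Qed.

Lemma Cinfty_cst W O (w : W) : open O -> Cinfty O (cst w).
Proof.
move=> oO k; elim: k w => [|k IH] w; first by move=> x _; exact: cst_continuous.
split=> [x _|i]; first exact: differentiable_cst.
by apply: Ck_ext (IH 0) => // x _; rewrite derive_cst.
Qed.

Lemma derive_mulmx_eq0 O m n p (A : 'rV[R]_2 -> 'M[R]_(m.+1, n.+1))
    (B : 'rV[R]_2 -> 'M[R]_(n.+1, p.+1)) x X :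
  open O -> O x -> differentiable A x -> differentiable B x ->
  (forall y, O y -> A y *m B y = 0) ->
  'D_X A x *m B x + A x *m 'D_X B x = 0.
Proof.
move=> oO Ox dA dB AB; rewrite -derive_mulmx //.
rewrite -[RHS](derive_cst (0 : 'M[R]_(m.+1, p.+1)) x X).
by apply: near_eq_derive; exact: (open_near oO Ox).
Qed.

Lemma derive_mink (g h : 'rV[R]_2 -> 'cV[R]_6) x X :
  differentiable g x -> differentiable h x ->
  'D_X (fun y => mink (g y) (h y)) x = mink ('D_X g x) (h x) + mink (g x) ('D_X h x).
Proof.
move=> dg dh; have dgG := differentiable_mulmx (differentiable_trmx dg)
  (@differentiable_cst _ _ _ (gram42 R) x).
rewrite -(derive_entry X 0 0 (differentiable_mulmx dgG dh)) derive_mulmx //.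
rewrite derive_mulmx; [|exact: differentiable_trmx|exact: differentiable_cst].
by rewrite derive_cst mulmx0 addr0 derive_trmx // mxE.
Qed.

Lemma derive_mink_eq0 O (g h : 'rV[R]_2 -> 'cV[R]_6) x X :
  open O -> O x -> differentiable g x -> differentiable h x ->
  (forall y, O y -> mink (g y) (h y) = 0) ->
  mink ('D_X g x) (h x) = - mink (g x) ('D_X h x).
Proof.
move=> oO Ox dg dh gh; apply/eqP; rewrite -addr_eq0 -derive_mink //; apply/eqP.
rewrite -[RHS](derive_cst (0 : R) x X).
by apply: near_eq_derive; exact: (open_near oO Ox).
Qed.

Lemma derive_zero_mink O (g h : 'rV[R]_2 -> 'cV[R]_6) x X :
  open O -> O x -> differentiable g x -> differentiable h x ->
  (forall y, O y -> mink (g y) (h y) = 0) -> g x = 0 ->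
  mink ('D_X g x) (h x) = 0.
Proof.
by move=> oO Ox dg dh gh gx; rewrite (derive_mink_eq0 _ oO Ox) // gx mink0l oppr0.
Qed.

End CinftyMaps.

Lemma derive_comp (R : realType) (V W Z : normedModType R) (t : V -> W)
    (g : W -> Z) x X :
  differentiable t x -> differentiable g (t x) ->
  'D_X (g \o t) x = 'D_('D_X t x) g (t x).
Proof.
move=> dt dg; rewrite deriveE; last exact: differentiable_comp.
by rewrite diff_comp // [in RHS]deriveE // deriveE.
Qed.

Lemma derive_comb2 (R : realType) (V W : normedModType R) (g h : V -> W) a b x X :
  differentiable g x -> differentiable h x ->
  'D_X (fun y => a *: g y + b *: h y) x = a *: 'D_X g x + b *: 'D_X h x.
Proof.
move=> dg dh; have dgX := diff_derivable (v := X) dg; have dhX := diff_derivable (v := X) dh.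
by rewrite -!deriveZ // -deriveD //; exact: derivableZ.
Qed.

Lemma derive_closed (R : realType) (W : normedModType R) (g0 g1 : 'rV[R]_2 -> W)
    (X Y x : 'rV[R]_2) :
  differentiable g0 x -> differentiable g1 x ->
  'D_(delta_mx 0 0) g1 x = 'D_(delta_mx 0 1) g0 x ->
  'D_X (fun y => Y 0 0 *: g0 y + Y 0 1 *: g1 y) x =
  'D_Y (fun y => X 0 0 *: g0 y + X 0 1 *: g1 y) x.
Proof.
have alg (v w z : W) (a b c d : R) : a *: (c *: v + d *: w) + b *: (c *: w + d *: z)
    = c *: (a *: v + b *: w) + d *: (a *: w + b *: z).
  by rewrite !scalerDr !scalerA [RHS]addrACA !(mulrC c) !(mulrC d).
move=> d0 d1 E; rewrite (derive_comb2 _ _ _ d0 d1) (derive_comb2 _ _ _ d0 d1).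
rewrite (derive_coord X d0) (derive_coord X d1) (derive_coord Y d0) (derive_coord Y d1) E.
exact: alg.
Qed.

(** * Charts *)

Section Charts.
Variables (R : realType) (Sigma : surface R).
Implicit Types (c : chart R Sigma) (W : normedModType R) (U : set Sigma).

Definition chart_im c U := ccod c `&` cinv c @^-1` U.

Lemma open_chart_im c U : open U -> open (chart_im c U).
Proof.
move=> oU; rewrite openE => x [cx Ux].
apply: filterI; first by apply: open_nbhs_nbhs; split=> //; exact: ccod_open.
by apply: (cinv_continuous cx); exact: open_nbhs_nbhs.
Qed.

(** Coordinate vector fields with constant coefficients [X], read in the tangent spaces
of the surface. *)
Definition chart_vector c (X : 'rV[R]_2) (x : 'rV[R]_2) : 'rV[R]_2 :=
  'D_X (cmap (chart_at (cinv c x)) \o cinv c) x.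

Lemma transition_differentiable c c' x : atlas c -> atlas c' -> ccod c x ->
  cdom c' (cinv c x) -> differentiable (cmap c' \o cinv c) x.
Proof. by move=> ac ac' cx c'x; apply: Cinfty_differentiable (atlas_smooth ac ac') _. Qed.

Lemma chart_vectorE c X x : atlas c -> ccod c x ->
  chart_vector c X x = X 0 0 *: coord_vector c 0 x + X 0 1 *: coord_vector c 1 x.
Proof.
move=> ac cx; apply: derive_coord; apply: transition_differentiable => //.
  exact: chart_at_atlas.
exact: chart_at_dom.
Qed.

(** The chain rule for the transition map to the preferred chart. *)
Lemma derive_chart W U (s : Sigma -> W) c X x : atlas c -> open U ->
  smooth_on U s -> chart_im c U x ->
  'D_X (s \o cinv c) x = dd s (cinv c x) (chart_vector c X x).
Proof.
move=> ac oU ss [cx Ux]; set c' := chart_at (cinv c x).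
have ac' : atlas c' by exact: chart_at_atlas.
have c'x : cdom c' (cinv c x) by exact: chart_at_dom.
have dt := transition_differentiable ac ac' cx c'x.
have ds : differentiable (s \o cinv c') (cmap c' (cinv c x)).
  apply: Cinfty_differentiable (ss c' ac') _; split; first exact: cmap_cod.
  by rewrite /= cmapK.
apply: etrans (derive_comp X dt ds).
apply: near_eq_derive; apply: (@open_near _ (chart_im c (cdom c'))) => //.
  by apply: open_chart_im; exact: cdom_open.
by move=> y [cy c'y] /=; rewrite cmapK.
Qed.

Lemma cmap_chart_im U p : U p -> chart_im (chart_at p) U (cmap (chart_at p) p).
Proof.
move=> Up; have dp := chart_at_dom p; split; first exact: cmap_cod.
by rewrite /= cmapK.
Qed.

Lemma chart_vector_center p X :
  chart_vector (chart_at p) X (cmap (chart_at p) p) = X.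
Proof.
have dp := chart_at_dom p; rewrite /chart_vector cmapK //.
rewrite -[RHS](derive_id (cmap (chart_at p) p)).
apply: near_eq_derive; apply: (open_near (ccod_open (c := chart_at p))).
  exact: cmap_cod.
by move=> y cy /=; rewrite cinvK.
Qed.

Lemma smooth_onD W U (s t : Sigma -> W) : open U ->
  smooth_on U s -> smooth_on U t -> smooth_on U (s + t).
Proof.
move=> oU ss st c ac; apply: CinftyD (ss c ac) (st c ac); exact: open_chart_im.
Qed.

Lemma smooth_onZ W U a (s : Sigma -> W) : open U ->
  smooth_on U s -> smooth_on U (a *: s).
Proof.
move=> oU ss c ac; apply: CinftyZ (ss c ac); exact: open_chart_im.
Qed.

Lemma smooth_on_sub W U U' (s : Sigma -> W) : U' `<=` U ->
  smooth_on U s -> smooth_on U' s.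
Proof. by move=> UU ss c ac; apply: Cinfty_sub (ss c ac) => x [cx /UU]. Qed.

End Charts.

#[local] Opaque derive mink perp.

(** * Contact sections and closed forms in a chart *)

Section LocalModel.
Variables (R : realType) (O : set 'rV[R]_2) (x : 'rV[R]_2).
Variables (F : 'rV[R]_2 -> {vspace 'cV[R]_6}) (K : 'rV[R]_2 -> 'rV[R]_2 -> 'M[R]_6).
Hypotheses (oO : open O) (Ox : O x).

(** Sections of a Legendre immersion, seen in a chart: their derivatives are orthogonal
to the bundle. *)
Definition contact_section (s : 'rV[R]_2 -> 'cV[R]_6) :=
  [/\ Cinfty O s, forall y, O y -> s y \in F y &
      forall X y, O y -> 'D_X s y \in perp (F y)].

(** What is used of a closed form with values in the wedge product of [F] and its
orthogonal, when [K X] is its value on the constant field [X]. *)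
Definition closed_potential :=
  [/\ forall X, Cinfty O (K X),
      forall X y v, O y -> v \in F y -> K X y *m v = 0,
      forall X y v, O y -> v \in perp (F y) -> K X y *m v \in F y,
      forall X y u v, O y -> mink (K X y *m u) v = - mink u (K X y *m v) &
      forall X Y, 'D_X (K Y) x = 'D_Y (K X) x].

(** Differentiate the contact condition along [X]. *)
Lemma derive_section_mink s t X Y : contact_section s -> contact_section t ->
  mink (s x) ('D_X ('D_Y t) x) = - mink ('D_X s x) ('D_Y t x).
Proof.
move=> ls lt; have [Cs Fs _] := ls; have [Ct _ Pt] := lt.
rewrite (@derive_mink_eq0 _ O s ('D_Y t)) ?opprK //.
- exact: Cinfty_differentiable Cs Ox.
- exact: Cinfty_differentiable (Cinfty_derive Y oO Ct) Ox.
by move=> y Oy; move/perpP: (Pt Y y Oy); apply; exact: Fs.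
Qed.

(** The symmetry of second derivatives, transported by [derive_section_mink]. *)
Lemma second_form_sym s t X Y : contact_section s -> contact_section t ->
  mink ('D_X s x) ('D_Y t x) = mink ('D_Y s x) ('D_X t x).
Proof.
move=> ls lt; apply: oppr_inj.
apply: etrans (esym (derive_section_mink X Y ls lt)) _.
apply: etrans (derive_section_mink Y X ls lt); apply: (congr1 (mink (s x))).
by apply: (schwarz _ _ oO Ox); case: lt.
Qed.

Hypothesis KC : closed_potential.

(** Differentiate [K X y *m s y = 0] and use closedness. *)
Lemma potential_sym s X Y : contact_section s ->
  K X x *m 'D_Y s x = K Y x *m 'D_X s x.
Proof.
move=> [Cs Fs _]; have [KO KF _ _ Kcl] := KC.
have ds := Cinfty_differentiable Cs Ox.
have dK Z := Cinfty_differentiable (KO Z) Ox.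
have E Z Z' : K Z x *m 'D_Z' s x = - ('D_Z' (K Z) x *m s x).
  apply/eqP; rewrite -addr_eq0 addrC; apply/eqP.
  by apply: (derive_mulmx_eq0 _ oO Ox) => // y Oy; apply: KF => //; exact: Fs.
by rewrite !E Kcl.
Qed.

Variables (S1 S2 : 'rV[R]_2 -> 'cV[R]_6) (X1 X2 : 'rV[R]_2).
Hypotheses (lS1 : contact_section S1) (lS2 : contact_section S2).
Hypotheses (c1 : 'D_X1 S1 x \in F x) (c2 : 'D_X2 S2 x \in F x).
Let u1 := 'D_X2 S1 x.
Let u2 := 'D_X1 S2 x.

Hypothesis Fiso : forall u v, u \in F x -> v \in F x -> mink u v = 0.

(** By symmetry the pairing is that of two vectors of the isotropic space [F x]. *)
Lemma curvature_orthogonal : mink u1 u2 = 0.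
Proof.
rewrite /u1 /u2 (second_form_sym X2 X1 lS1 lS2); exact: Fiso.
Qed.

Lemma potential_u1 : K X1 x *m u1 = 0.
Proof. by rewrite (potential_sym _ _ lS1); case: KC => _ KF _ _ _; exact: KF. Qed.

Lemma potential_u2 : K X2 x *m u2 = 0.
Proof. by rewrite (potential_sym _ _ lS2); case: KC => _ KF _ _ _; exact: KF. Qed.

(** [K Y] maps the orthogonal of [F] into [F], hence pairs [u1] and [u2] to zero on the
whole open set; this is the derivative of that identity. *)
Lemma derive_potential_mink X Y :
  mink ('D_X (K Y) x *m u1) u2 = mink (K Y x *m u2) ('D_X ('D_X2 S1) x)
     - mink (K Y x *m u1) ('D_X ('D_X1 S2) x).
Proof.
have alg (a b c d e : R) : a + b = - c -> b = - d -> e = d -> a = e - c by lra.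
have [C1 _ P1] := lS1; have [C2 _ P2] := lS2; have [KO KF KI Ks _] := KC.
have CD1 := Cinfty_derive X2 oO C1; have CD2 := Cinfty_derive X1 oO C2.
have dK := Cinfty_differentiable (KO Y) Ox.
have d1 := Cinfty_differentiable CD1 Ox; have d2 := Cinfty_differentiable CD2 Ox.
have Z : forall y, O y -> mink (K Y y *m 'D_X2 S1 y) ('D_X1 S2 y) = 0.
  move=> y Oy; move/perpP: (P2 X1 y Oy); apply.
  by apply: KI => //; exact: P1.
have := derive_mink_eq0 X oO Ox (differentiable_mulmx dK d1) d2 Z.
rewrite derive_mulmx // minkDl => E.
exact: (alg _ _ _ _ _ E (Ks Y x ('D_X ('D_X2 S1) x) u2 Ox) (minkC _ _)).
Qed.

(** Closedness equates the derivatives of [derive_potential_mink] for the pairs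
[(X1, X2)] and [(X2, X1)]; every second derivative that occurs is paired with a vector of
[F x] and can be reduced to first order by [derive_section_mink].  The gauge
transformation by [g *: wedge S1 S2] changes [p] and [r'] but preserves this relation. *)
Lemma potential_relation p r p' r' :
  K X1 x *m u2 = p *: S1 x + r *: S2 x ->
  K X2 x *m u1 = p' *: S1 x + r' *: S2 x ->
  r' * mink u2 u2 = - (p * mink u1 u1).
Proof.
move=> E2 E1.
have alg (p0 r0 q0 s0 a b c d n1 n2 : R) : p0 * a + r0 * b = - (q0 * c + s0 * d) ->
  a = - n1 -> b = - 0 -> c = - 0 -> d = - n2 -> s0 * n2 = - (p0 * n1).
  by move=> E Ea Eb Ec Ed; rewrite Ea Eb Ec Ed in E; lra.
have [_ _ P1] := lS1; have [_ _ P2] := lS2.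
have /perpP u1F := P1 X2 x Ox; have /perpP u2F := P2 X1 x Ox.
have := derive_potential_mink X1 X2; rewrite potential_u2 E1 mink0l.
have := derive_potential_mink X2 X1; rewrite potential_u1 E2 mink0l.
case: KC => _ _ _ _ ->; rewrite subr0 sub0r => -> .
rewrite !minkDl !minkZl => E.
exact: (alg _ _ _ _ _ _ _ _ _ _ E (derive_section_mink _ _ lS1 lS1)
  (etrans (derive_section_mink _ _ lS2 lS1) (congr1 _ (u1F _ c2)))
  (etrans (derive_section_mink _ _ lS1 lS2) (congr1 _ (u2F _ c1)))
  (derive_section_mink _ _ lS2 lS2)).
Qed.

End LocalModel.

(** * From the surface to a chart *)

Section Pullback.
Variables (R : realType) (Sigma : surface R).
Variables (f : Sigma -> {vspace 'cV[R]_6}) (eta : Sigma -> {linear 'rV[R]_2 -> 'M[R]_6}).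
Implicit Types (U : set Sigma) (c : chart R Sigma).

Lemma mem_lspan (W : lmodType R) (S : set W) v : S v -> lspan S v.
Proof.
move=> Sv; exists 1, (fun=> 1), (fun=> v); split=> //.
by rewrite big_ord1 scale1r.
Qed.

Lemma legendre_derive_perp U s p X : legendre_immersion f -> open_nbhs p U ->
  section_on f U s -> dd s p X \in perp (f p).
Proof.
move=> [_ _ fder _] pU sU; have : derived_bundle f p (dd s p X).
  by apply: mem_lspan; exists s; split; [exists U|right; exists X].
by rewrite fder.
Qed.

Lemma contact_section_chart U s c : legendre_immersion f -> open U ->
  section_on f U s -> atlas c ->
  contact_section (chart_im c U) (f \o cinv c) (s \o cinv c).
Proof.
move=> fL oU sU ac; have [ss sf] := sU; split; first exact: ss.
  by move=> y [_ Uy]; exact: sf.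
move=> X y yU; rewrite (derive_chart X ac oU ss yU) /=.
by apply: legendre_derive_perp fL _ sU; split=> //; case: yU.
Qed.

(** The value of [eta] on the constant field [X], see [chart_formE]; in this form its
smoothness is visible. *)
Definition chart_form c (X y : 'rV[R]_2) : 'M[R]_6 :=
  X 0 0 *: form_coef eta c 0 y + X 0 1 *: form_coef eta c 1 y.

Lemma chart_formE c X y : atlas c -> ccod c y ->
  chart_form c X y = eta (cinv c y) (chart_vector c X y).
Proof.
move=> ac cy; apply: etrans (esym (linear_comb2 (eta (cinv c y)) _ _ _ _)) _.
by apply: congr1; rewrite chart_vectorE.
Qed.

Lemma wedge_perp_skew p X u v : valued_in_f_wedge_perp f eta ->
  mink (eta p X *m u) v = - mink u (eta p X *m v).
Proof.
move=> /(_ p X) [n [a [w [wE ->]]]]; rewrite !mulmx_suml.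
elim/big_rec2: _ => [|i y1 y2 _ IH]; first by rewrite mink0l mink0r oppr0.
have [b [d [_ _ ->]]] := wE i.
rewrite minkDl minkDr opprD IH; congr (_ + _).
by rewrite -!scalemxAl minkZl minkZr mink_wedge mulrN.
Qed.

Lemma wedge_perp_mem p X v : isotropic f -> valued_in_f_wedge_perp f eta ->
  v \in perp (f p) -> eta p X *m v \in f p.
Proof.
move=> fi /(_ p X) [n [a [w [wE ->]]]] /perpP vf; rewrite mulmx_suml.
apply: memv_suml => i _; have [b [d [bf /perpP df ->]]] := wE i.
rewrite -scalemxAl wedgeE vf // scale0r sub0r.
by rewrite memvZ // memvN memvZ.
Qed.

Lemma wedge_perp_ker p X v : isotropic f -> valued_in_f_wedge_perp f eta ->
  v \in f p -> eta p X *m v = 0.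
Proof.
move=> fi /(_ p X) [n [a [w [wE ->]]]] vf; rewrite mulmx_suml.
apply: big1 => i _; have [b [d [bf /perpP df ->]]] := wE i.
by rewrite -scalemxAl wedgeE (fi p) // minkC df // !scale0r subr0 scaler0.
Qed.

Lemma closed_potential_chart U c y : isotropic f -> smooth_form eta ->
  valued_in_f_wedge_perp f eta -> closed_form eta -> open U -> atlas c ->
  chart_im c U y ->
  closed_potential (chart_im c U) y (f \o cinv c) (chart_form c).
Proof.
move=> fi es ev ecl oU ac Uy; split.
- move=> X; have oc := open_chart_im (c := c) oU.
  have h i : Cinfty (chart_im c U) (form_coef eta c i).
    by apply: Cinfty_sub (es c i ac) => z [].
  by apply: CinftyD => //; exact: CinftyZ.
- by move=> X z v [cz _] vf; rewrite chart_formE // (wedge_perp_ker _ fi).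
- by move=> X z v [cz _] vf; rewrite chart_formE // (wedge_perp_mem _ fi).
- by move=> X z u v [cz _]; rewrite chart_formE // wedge_perp_skew.
move=> X Y; have cy : ccod c y by case: Uy.
have de i := Cinfty_differentiable (es c i ac) cy.
exact: derive_closed (de 0) (de 1) (ecl c y ac cy).
Qed.

End Pullback.

(** * Derivatives of sections at a point *)

Section SectionDerivatives.
Variables (R : realType) (Sigma : surface R).
Local Notation V := 'cV[R]_6.
Implicit Types (F f : Sigma -> {vspace V}) (s t : Sigma -> V) (U : set Sigma).

Lemma section_differentiable U s p : smooth_on U s -> U p ->
  differentiable (s \o cinv (chart_at p)) (cmap (chart_at p) p).
Proof.
move=> ss Up; apply: Cinfty_differentiable (ss _ (chart_at_atlas p)) _.
exact: cmap_chart_im.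
Qed.

Lemma section_on_sub F U U' s : U' `<=` U -> section_on F U s -> section_on F U' s.
Proof. by move=> UU [ss sF]; split=> [|x /UU]; [exact: smooth_on_sub ss|exact: sF]. Qed.

Lemma section_near_differentiable F s p : section_near F p s ->
  differentiable (s \o cinv (chart_at p)) (cmap (chart_at p) p).
Proof. by move=> [U [_ Up] [ss _]]; exact: section_differentiable ss Up. Qed.

Lemma dd_comb F p s a b X Y : section_near F p s ->
  dd s p (a *: X + b *: Y) = a *: dd s p X + b *: dd s p Y.
Proof.
move=> /section_near_differentiable ds.
by rewrite /dd !deriveE //; exact: linear_comb2.
Qed.

Lemma dd_scale F p s a X : section_near F p s -> dd s p (a *: X) = a *: dd s p X.
Proof.
move=> sF; have := dd_comb a 0 X X sF.
by rewrite !scale0r !addr0.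
Qed.

Lemma section_near_mem F p s : section_near F p s -> s p \in F p.
Proof. by move=> [U [_ Up] [_]]; apply. Qed.

Lemma section_near_comb F p s t a b : section_near F p s -> section_near F p t ->
  section_near F p (a *: s + b *: t).
Proof.
move=> [U [oU Up] [ss sF]] [U' [oU' Up'] [ts tF]].
have oUU := openI oU oU'; exists (U `&` U'); first by split.
split.
  apply: smooth_onD => //; apply: smooth_onZ => //.
    by apply: smooth_on_sub ss => x [].
  by apply: smooth_on_sub ts => x [].
by move=> x [Ux U'x]; rewrite memvD // memvZ; [|exact: sF| |exact: tF].
Qed.

Lemma dd_section_comb F p s t a b X : section_near F p s -> section_near F p t ->
  dd (a *: s + b *: t) p X = a *: dd s p X + b *: dd t p X.
Proof.
move=> /section_near_differentiable ds /section_near_differentiable dt.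
exact: derive_comb2 ds dt.
Qed.

(** Derivatives of sections modulo [F p] depend on the values at [p] only. *)
Definition tensorial F p :=
  forall s X, section_near F p s -> s p = 0 -> dd s p X \in F p.

Lemma tensorial_comb F p s S1 S2 a b X : tensorial F p ->
  section_near F p s -> section_near F p S1 -> section_near F p S2 ->
  s p = a *: S1 p + b *: S2 p ->
  dd s p X - (a *: dd S1 p X + b *: dd S2 p X) \in F p.
Proof.
move=> FT sF S1F S2F E; have cF := section_near_comb a b S1F S2F.
have := FT (1 *: s + (-1) *: (a *: S1 + b *: S2)) X (section_near_comb _ _ sF cF).
rewrite (dd_section_comb _ _ _ sF cF) (dd_section_comb _ _ _ S1F S2F).
have lin (v w : V) : 1 *: v + (-1) *: w = v - w by rewrite scaleN1r scale1r.
by rewrite lin; apply; rewrite !fctE E lin subrr.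
Qed.

(** For sections [s] and [t], differentiating the contact condition shows that
[dd s p X] pairs with [dd t p Y] as [s p = 0] does with a second derivative of [t].  Since
such vectors [dd t p Y] and [F p] span the orthogonal of [F p], the vector [dd s p X] lies
in the double orthogonal. *)
Lemma legendre_tensorial f p : legendre_immersion f -> tensorial f p.
Proof.
move=> fL s X [U [oU Up] sU] s0; have [_ _ fder _] := fL.
rewrite -[f p]perpK; apply/perpP => u.
have : [set v | v \in perp (f p)] u -> derived_bundle f p u by rewrite fder.
move=> /[apply] -[n [a [w [wE ->]]]].
elim/big_rec: _ => [|i y _ IH]; first exact: mink0l.
rewrite minkDl minkZl IH addr0; have [t [[U' [oU' Up'] tU] tw]] := wE i.
suff -> : mink (w i) (dd s p X) = 0 by rewrite mulr0.
case: tw => [->|[Y ->]].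
  have /perpP := legendre_derive_perp X fL (conj oU Up) sU.
  by apply; case: tU => _; exact.
have oUU := openI oU oU'; have UUp : (U `&` U') p by split.
have ac := chart_at_atlas p; have pO := cmap_chart_im UUp.
have oO := open_chart_im (c := chart_at p) oUU.
have cs : contact_section _ _ (s \o cinv (chart_at p)) :=
  contact_section_chart fL oUU (section_on_sub (@subIsetl _ _ _) sU) ac.
have ct : contact_section _ _ (t \o cinv (chart_at p)) :=
  contact_section_chart fL oUU (section_on_sub (@subIsetr _ _ _) tU) ac.
have := derive_section_mink oO pO X Y cs ct; rewrite /= cmapK ?s0; last exact: chart_at_dom.
by rewrite mink0l minkC => /eqP; rewrite eq_sym oppr_eq0 => /eqP.
Qed.

Lemma dim_subbundle F k p : subbundle F k -> \dim (F p) = k.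
Proof.
move=> /(_ p) [U [s [[_ Up] _ /(_ p Up) b]]].
by rewrite -(span_basis b) (eqnP (basis_free b)) size_map size_enum_ord.
Qed.

Lemma curvature_direction f p L T :
  curvature_sphere f p L -> curvature_space f p L T -> exists2 X, X != 0 & X \in T.
Proof.
move=> [_ _ [T' T'0 Tc]] [_ /(_ T' Tc) T'T].
by exists (vpick T'); rewrite ?vpick0 // (subvP T'T) // memv_pick.
Qed.

Lemma mink_dd U s t p X :
  open U -> U p -> smooth_on U s -> smooth_on U t ->
  (forall x, U x -> mink (s x) (t x) = 0) ->
  mink (dd s p X) (t p) = - mink (s p) (dd t p X).
Proof.
move=> oU Up ss st st0; have pO := cmap_chart_im Up.
have := derive_mink_eq0 X (open_chart_im (c := chart_at p) oU) pO
  (section_differentiable ss Up) (section_differentiable st Up).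
rewrite /= cmapK; last exact: chart_at_dom.
by apply=> y [_ Uy]; exact: st0.
Qed.

End SectionDerivatives.

(** The relations of a chart at its base point, where [chart_form] is [eta] itself. *)
Lemma curvature_relations (R : realType) (Sigma : surface R)
    (f : Sigma -> {vspace 'cV[R]_6}) (eta : Sigma -> {linear 'rV[R]_2 -> 'M[R]_6})
    (U : set Sigma) sg1 sg2 p X1 X2 :
  legendre_immersion f -> smooth_form eta -> valued_in_f_wedge_perp f eta ->
  closed_form eta -> open_nbhs p U -> section_on f U sg1 -> section_on f U sg2 ->
  dd sg1 p X1 \in f p -> dd sg2 p X2 \in f p ->
  let u1 := dd sg1 p X2 in let u2 := dd sg2 p X1 in
  [/\ mink u1 u2 = 0, eta p X1 *m u1 = 0, eta p X2 *m u2 = 0 &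
      forall p1 r1 p2 r2, eta p X1 *m u2 = p1 *: sg1 p + r1 *: sg2 p ->
        eta p X2 *m u1 = p2 *: sg1 p + r2 *: sg2 p ->
        r2 * mink u2 u2 = - (p1 * mink u1 u1)].
Proof.
move=> fL es ev ecl [oU Up] s1 s2 c1 c2; have fi : isotropic f by case: fL.
pose c := chart_at p; have ac := chart_at_atlas p; have pO := cmap_chart_im Up.
have oO := open_chart_im (c := c) oU.
have cp : cinv c (cmap c p) = p by rewrite cmapK //; exact: chart_at_dom.
have K := closed_potential_chart fi es ev ecl oU ac pO.
have KE X : chart_form eta c X (cmap c p) = eta p X.
  by case: pO => cpO _; rewrite chart_formE // chart_vector_center cp.
have lS1 := contact_section_chart fL oU s1 ac.
have lS2 := contact_section_chart fL oU s2 ac.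
have F1 : 'D_X1 (sg1 \o cinv c) (cmap c p) \in (f \o cinv c) (cmap c p).
  by rewrite /= cp.
have F2 : 'D_X2 (sg2 \o cinv c) (cmap c p) \in (f \o cinv c) (cmap c p).
  by rewrite /= cp.
have Fi u v : u \in (f \o cinv c) (cmap c p) -> v \in (f \o cinv c) (cmap c p) ->
  mink u v = 0 by exact: fi.
move=> u1 u2; split; first exact (curvature_orthogonal oO pO lS1 lS2 F1 F2 Fi).
- by have := potential_u1 oO pO K X2 lS1 F1; rewrite KE.
- by have := potential_u2 oO pO K X1 lS2 F2; rewrite KE.
move=> p1 r1 p2 r2 E2 E1.
apply: (potential_relation oO pO K lS1 lS2 F1 F2); rewrite KE /= cp; [exact: E2|exact: E1].
Qed.

#[local] Opaque dd.

(** * Curvature spheres in a frame *)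

Lemma curvature_combination (R : comPzRingType) (W : lmodType R) (v1 v2 h1 h2 : W)
    (a b x y a1 a2 : R) :
  (x * (a - b * a1)) *: v1 + (y * (a - b * a2)) *: v2 =
  a *: (x *: v1 + y *: v2) + b *: (x *: h1 + y *: h2) -
  ((b * x) *: (h1 + a1 *: v1) + (b * y) *: (h2 + a2 *: v2)).
Proof.
rewrite !scalerDr !scalerA (addrACA ((b * x) *: h1)) opprD addrA addrK opprD addrACA.
by rewrite -!scalerBl !mulrBr !mulrA ![_ * a]mulrC ![_ * b]mulrC.
Qed.

Section CurvatureSpheresInFrame.
Variables (R : realType) (Sigma : surface R) (F : Sigma -> {vspace 'cV[R]_6}).
Variables (p : Sigma) (S0 H : Sigma -> 'cV[R]_6) (X1 X2 : 'rV[R]_2) (a1 a2 : R).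
Hypotheses (FT : tensorial F p) (S0F : section_near F p S0) (HF : section_near F p H).
Hypothesis Fspan : forall v, v \in F p -> exists a b, v = a *: S0 p + b *: H p.
Hypothesis Ffree : forall a b, a *: S0 p + b *: H p = 0 -> a = 0 /\ b = 0.
Hypothesis Xspan : forall X, exists x y, X = x *: X1 + y *: X2.
Hypotheses (c1 : dd H p X1 + a1 *: dd S0 p X1 \in F p)
  (c2 : dd H p X2 + a2 *: dd S0 p X2 \in F p).
Hypothesis indep : forall x y,
  x *: dd S0 p X1 + y *: dd S0 p X2 \in F p -> x = 0 /\ y = 0.

Lemma frame_direction_neq0 : X1 != 0 /\ X2 != 0.
Proof.
have dd0 : dd S0 p 0 = 0 by rewrite -(scale0r 0) (dd_scale _ _ S0F) scale0r.
split; apply/eqP => X0.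
  by have := @indep 1 0; rewrite X0 dd0 scaler0 scale0r addr0 mem0v => /(_ isT) [/eqP];
    rewrite oner_eq0.
by have := @indep 0 1; rewrite X0 dd0 scaler0 scale0r addr0 mem0v => /(_ isT) [_ /eqP];
    rewrite oner_eq0.
Qed.

(** By tensoriality it suffices to test multiples of one section through the line. *)
Lemma curvature_sphere_line X a : X != 0 -> dd H p X + a *: dd S0 p X \in F p ->
  curvature_sphere F p <[a *: S0 p + H p]>%VS.
Proof.
move=> X0 cX.
have v0 : a *: S0 p + H p != 0.
  by apply/eqP; rewrite -[H p]scale1r => /Ffree [_ /eqP]; rewrite oner_eq0.
split; first by rewrite dim_vline v0.
  by rewrite -memvE memvD ?memvZ // section_near_mem.
exists <[X]>%VS; first by rewrite -dimv_eq0 dim_vline X0.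
move=> _ s /vlineP[x ->] sF /vlineP[c sE].
have E : s p = (c * a) *: S0 p + c *: H p by rewrite sE scalerDr scalerA.
have := tensorial_comb (x *: X) FT sF S0F HF E.
rewrite (dd_scale _ _ S0F) (dd_scale _ _ HF) => M.
rewrite -[dd s _ _](subrK ((c * a) *: (x *: dd S0 p X) + c *: (x *: dd H p X))).
rewrite memvD // !scalerA; have -> : (c * a * x) *: dd S0 p X + (c * x) *: dd H p X =
    (c * x) *: (dd H p X + a *: dd S0 p X).
  by rewrite scalerDr scalerA addrC mulrAC.
exact: memvZ.
Qed.

(** A section with value [a *: S0 p + b *: H p] has derivative
[x * (a - b * a1) *: dd S0 p X1 + y * (a - b * a2) *: dd S0 p X2] along
[x *: X1 + y *: X2], modulo [F p].  For this to vanish with [x] or [y] nonzero, [a] must be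
[b * a1] or [b * a2]. *)
Lemma curvature_sphere_frame L : curvature_sphere F p L <->
  L = <[a1 *: S0 p + H p]>%VS \/ L = <[a2 *: S0 p + H p]>%VS.
Proof.
have [X10 X20] := frame_direction_neq0.
split; last first.
  by case=> ->; [exact: curvature_sphere_line X10 c1|exact: curvature_sphere_line X20 c2].
move=> [dL LF [T T0 Tc]]; have [v vL] : exists v, L = <[v]>%VS.
  by exists (vpick L); apply/eqP; rewrite eq_sym eqEdim -memvE memv_pick dL dim_vline
    vpick0 -dimv_eq0 dL.
have vF : v \in F p by rewrite (subvP LF) // vL memv_line.
have [a [b vE]] := Fspan vF.
have [x [y XE]] := Xspan (vpick T).
have X0 : vpick T != 0 by rewrite vpick0.
have sF := section_near_comb a b S0F HF.
have M : a *: dd S0 p (vpick T) + b *: dd H p (vpick T) \in F p.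
  rewrite -(dd_section_comb _ _ _ S0F HF).
  by apply: Tc (memv_pick T) sF _; rewrite vL -[v]scale1r vE !fctE scale1r memv_line.
have [xE yE] : x * (a - b * a1) = 0 /\ y * (a - b * a2) = 0.
  apply: indep.
  have -> : (x * (a - b * a1)) *: dd S0 p X1 + (y * (a - b * a2)) *: dd S0 p X2 =
     a *: dd S0 p (vpick T) + b *: dd H p (vpick T) -
     ((b * x) *: (dd H p X1 + a1 *: dd S0 p X1) + (b * y) *: (dd H p X2 + a2 *: dd S0 p X2)).
    rewrite XE (dd_comb _ _ _ _ S0F) (dd_comb _ _ _ _ HF).
    exact: curvature_combination.
  exact: memvB M (memvD (memvZ _ c1) (memvZ _ c2)).
have Lline b' : a - b * b' = 0 -> L = <[b' *: S0 p + H p]>%VS.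
  move=> /subr0_eq ab; have vb : v = b *: (b' *: S0 p + H p).
    by rewrite vE ab scalerDr scalerA.
  apply/eqP; rewrite eqEdim vL -memvE vb memvZ ?memv_line //=.
  by rewrite -vb -vL dL dim_vline leq_b1.
have [x0|x0] := eqVneq x 0.
  have y0 : y != 0 by apply: contra X0 => /eqP y0; rewrite XE x0 y0 !scale0r addr0.
  by right; apply: Lline; apply: (mulfI y0); rewrite yE mulr0.
by left; apply: Lline; apply: (mulfI x0); rewrite xE mulr0.
Qed.

Lemma umbilic_frame : umbilic F p <-> a1 = a2.
Proof.
split=> [[L [_ Lu]]|a12]; last first.
  exists <[a1 *: S0 p + H p]>%VS; split; first by apply/curvature_sphere_frame; left.
  by move=> L' /curvature_sphere_frame; rewrite -a12; case=> ->.
have E1 := Lu _ (iffRL (curvature_sphere_frame _) (or_introl erefl)).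
have := Lu _ (iffRL (curvature_sphere_frame _) (or_intror erefl)); rewrite {}E1 => E.
have : a1 *: S0 p + H p \in <[a2 *: S0 p + H p]>%VS by rewrite -E memv_line.
move=> /vlineP[k kE]; have [e1 e2] : a1 - k * a2 = 0 /\ 1 - k = 0.
  apply: Ffree; rewrite !scalerBl scale1r -scalerA addrACA -opprD -scalerDr -kE.
  by rewrite subrr.
by move: e1; rewrite -(subr0_eq e2) mul1r; exact: subr0_eq.
Qed.

End CurvatureSpheresInFrame.

(** * Darboux transforms *)

(** By [rel], the terms with [p1] and [r2] cancel in the difference of the two sides. *)
Lemma darboux_algebra (R : realType) (m a b p1 r1 p2 r2 N1 N2 : R) :
  m != 0 -> a != 0 -> b != 0 -> N1 != 0 -> N2 != 0 -> r2 * N2 = - (p1 * N1) ->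
  m * (p1 * b - r1 * a) / (b * N2) = m * (p2 * b - r2 * a) / (a * N1) <->
  p2 * b ^+ 2 * N2 + r1 * a ^+ 2 * N1 = 0.
Proof.
move=> m0 a0 b0 N10 N20 rel.
have E : (m * (p2 * b - r2 * a) / (a * N1) - m * (p1 * b - r1 * a) / (b * N2)) *
    (a * b * N1 * N2 / m) = p2 * b ^+ 2 * N2 + r1 * a ^+ 2 * N1.
  have -> : p2 * b ^+ 2 * N2 + r1 * a ^+ 2 * N1 = p2 * b ^+ 2 * N2 + r1 * a ^+ 2 * N1
    - a * b * (r2 * N2 + p1 * N1) by rewrite rel addNr mulr0 subr0.
  by field; rewrite ?m0 ?a0 ?b0 ?N10 ?N20.
rewrite -E; split=> [->|/eqP]; first by rewrite subrr mul0r.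
rewrite mulf_eq0 => /orP[/eqP/subr0_eq ->//|].
by rewrite !mulf_eq0 invr_eq0 (negPf m0) (negPf a0) (negPf b0) (negPf N10) (negPf N20).
Qed.

Section DarbouxTransform.
Variables (R : realType) (Sigma : surface R).
Local Notation V := 'cV[R]_6.
Variables (f shat : Sigma -> {vspace V}) (eta : Sigma -> {linear 'rV[R]_2 -> 'M[R]_6}).
Variables (m : R) (U : set Sigma) (sg1 sg2 H : Sigma -> V).
Hypotheses (fL : legendre_immersion f) (ev : valued_in_f_wedge_perp f eta).
Hypotheses (oU : open U) (sg1U : section_on f U sg1) (sg2U : section_on f U sg2).
Hypotheses (HU : section_on shat U H) (shatE : forall x, U x -> shat x = <[H x]>%VS).
Hypotheses (shat_null : null_subbundle shat) (shat_par : parallel_subbundle eta m shat).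

Let fhat x := (perp (shat x) :&: f x + shat x)%VS.
Let S0 x := wedge (sg2 x) (sg1 x) *m H x.

Let fi : isotropic f. Proof. by case: fL. Qed.

(** The section [S0] of [f] is orthogonal to [H] by construction, and it depends smoothly on
the three lifts. *)
Lemma polar_sectionE x :
  S0 x = mink (sg2 x) (H x) *: sg1 x - mink (sg1 x) (H x) *: sg2 x.
Proof. exact: wedgeE. Qed.

Lemma section_near_on F s : section_on F U s -> forall x, U x -> section_near F x s.
Proof. by move=> sU x Ux; exists U. Qed.

Lemma polar_section_f : section_on f U S0.
Proof.
split=> [c ac|x Ux].
  have oc := open_chart_im (c := c) oU.
  have C1 := sg1U.1 c ac; have C2 := sg2U.1 c ac; have CH := HU.1 c ac.
  apply: Cinfty_mulmx => //; apply: Cinfty_mulmx => //; last exact: Cinfty_cst.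
  have E : (fun y => sg1 (cinv c y) *m (sg2 (cinv c y))^T - sg2 (cinv c y) *m (sg1 (cinv c y))^T) =
    (fun y => sg1 (cinv c y) *m (sg2 (cinv c y))^T) +
    (-1) *: (fun y => sg2 (cinv c y) *m (sg1 (cinv c y))^T).
    by apply/funext => y; rewrite !fctE scaleN1r.
  by rewrite E; apply: CinftyD => //; [|apply: CinftyZ => //];
    apply: Cinfty_mulmx => //; exact: Cinfty_trmx.
by rewrite polar_sectionE memvB // memvZ //; [case: sg1U => _|case: sg2U => _]; exact.
Qed.

Lemma mink_HH x : U x -> mink (H x) (H x) = 0.
Proof. by move=> Ux; apply: (shat_null (p := x)); rewrite shatE // memv_line. Qed.

Lemma polar_section_perp x : mink (S0 x) (H x) = 0.
Proof. by rewrite polar_sectionE !minkl; ring. Qed.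

Lemma mem_perp_shat x v : U x -> mink v (H x) = 0 -> v \in perp (shat x).
Proof.
move=> Ux vH; apply/perpP => u; rewrite shatE // => /vlineP[k ->].
by rewrite minkZl minkC vH mulr0.
Qed.

Lemma polar_section_fhat : section_on fhat U S0.
Proof.
have [ss sf] := polar_section_f; split=> // x Ux; rewrite -[S0 x]addr0.
rewrite memv_add ?mem0v // memv_cap sf // andbT.
by apply: mem_perp_shat => //; exact: polar_section_perp.
Qed.

Lemma parallel_section_fhat : section_on fhat U H.
Proof.
have [ss sf] := HU; split=> // x Ux; rewrite -[H x]add0r.
by rewrite memv_add ?mem0v // sf.
Qed.

Lemma fhatP x v : U x -> reflect
  (exists u b, [/\ u \in f x, mink u (H x) = 0 & v = u + b *: H x]) (v \in fhat x).
Proof.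
move=> Ux; apply: (iffP memv_addP).
  move=> [u + [w wH ->]]; rewrite memv_cap => /andP[/perpP up uf].
  move: wH; rewrite shatE // => /vlineP[b ->]; exists u, b; split=> //.
  by rewrite minkC up // shatE // memv_line.
move=> [u [b [uf uH ->]]]; exists u.
  by rewrite memv_cap uf mem_perp_shat.
by exists (b *: H x); rewrite ?shatE // memvZ ?memv_line.
Qed.

Lemma fhat_isotropic x u v : U x -> u \in fhat x -> v \in fhat x -> mink u v = 0.
Proof.
move=> Ux /(fhatP _ Ux) [u' [b [uf uH ->]]] /(fhatP _ Ux) [v' [b' [vf vH ->]]].
rewrite !minkl (fi uf vf) uH (minkC _ v') vH mink_HH //.
by rewrite !(mulr0, addr0).
Qed.

Lemma parallel_dd x X : U x ->
  exists k, dd H x X = k *: H x - m *: (eta x X *m H x).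
Proof.
move=> Ux; have := shat_par X (section_near_on HU Ux).
rewrite shatE // => /vlineP[k kE]; exists k.
by rewrite -kE addrK.
Qed.

(** Since [S0] is a section of [f], only the pairing with [H] has to be computed; it is
moved to the derivative of [H], and [eta] kills [S0]. *)
Lemma polar_section_contact x X : U x -> dd S0 x X \in perp (fhat x).
Proof.
move=> Ux; apply/perpP => _ /(fhatP _ Ux)[u [b [uf uH ->]]].
have /perpP fp := legendre_derive_perp X fL (conj oU Ux) polar_section_f.
rewrite minkDl fp // add0r minkZl minkC.
rewrite (mink_dd X oU Ux polar_section_f.1 HU.1 (fun x _ => polar_section_perp x)).
have [k ->] := parallel_dd X Ux; have S0f := polar_section_f.2 x Ux.
have E : mink (S0 x) (eta x X *m H x) = 0.
  by rewrite minkC (wedge_perp_skew _ _ _ _ ev) (wedge_perp_ker _ fi ev S0f) mink0r oppr0.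
by rewrite !minkl E polar_section_perp !(mulr0, addr0, oppr0).
Qed.

Variable p : Sigma.
Hypothesis Up : U p.
Hypotheses (h1 : mink (sg1 p) (H p) != 0) (h2 : mink (sg2 p) (H p) != 0).
Hypothesis fspan : forall v, v \in f p -> exists a b, v = a *: sg1 p + b *: sg2 p.
Hypothesis ffree : forall a b, a *: sg1 p + b *: sg2 p = 0 -> a = 0 /\ b = 0.

Let sg1p : sg1 p \in f p. Proof. exact: sg1U.2. Qed.
Let sg2p : sg2 p \in f p. Proof. exact: sg2U.2. Qed.
Let a := mink (sg2 p) (H p).
Let b := - mink (sg1 p) (H p).

Let S0p : S0 p = a *: sg1 p + b *: sg2 p.
Proof. by rewrite polar_sectionE scaleNr. Qed.

Lemma dim_f : \dim (f p) = 2%N.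
Proof. exact: dim_frame2 fspan ffree. Qed.

Lemma fhat_span v : v \in fhat p -> exists x y, v = x *: S0 p + y *: H p.
Proof.
move=> /(fhatP _ Up)[u [y [/fspan [x1 [x2 uE]] uH ->]]].
exists (x1 / a), y; congr (_ + _); rewrite uE S0p scalerDr !scalerA divfK //.
congr (_ + _ *: _); apply: (mulIf h2); rewrite -[mink (sg2 p) _]/a.
rewrite mulrAC divfK //.
move: uH; rewrite uE !minkl -/a addrC => /eqP; rewrite addr_eq0 => /eqP ->.
by rewrite mulrN.
Qed.

Lemma fhat_free x y : x *: S0 p + y *: H p = 0 -> x = 0 /\ y = 0.
Proof.
move=> E; have S0f : S0 p \in f p by exact: polar_section_f.2.
have y0 : y = 0.
  have := congr1 (mink (sg1 p)) E; rewrite !minkl (fi sg1p S0f) mulr0 add0r.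
  by move/eqP; rewrite mulf_eq0 (negPf h1) orbF => /eqP.
split=> //; move: E; rewrite y0 scale0r addr0 S0p scalerDr !scalerA => /ffree [+ _].
by move/eqP; rewrite mulf_eq0 (negPf h2) orbF => /eqP.
Qed.

Let S0n : section_near fhat p S0.
Proof. exact: section_near_on polar_section_fhat _ Up. Qed.

Let Hn : section_near fhat p H.
Proof. exact: section_near_on parallel_section_fhat _ Up. Qed.

Lemma dim_fhat : \dim (fhat p) = 2%N.
Proof.
exact: dim_frame2 (section_near_mem S0n) (section_near_mem Hn) fhat_span fhat_free.
Qed.

Lemma meet_fhat : (f p :&: fhat p)%VS = <[a *: sg1 p + b *: sg2 p]>%VS.
Proof.
rewrite -S0p; apply/eqP; rewrite eqEsubv -memvE memv_cap polar_section_f.2 //.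
rewrite (section_near_mem S0n) !andbT; apply/subvP => v; rewrite memv_cap => /andP[vf].
move=> /fhat_span [x [y vE]]; have S0f : S0 p \in f p by exact: polar_section_f.2.
have := fi sg1p vf; rewrite vE !minkl (fi sg1p S0f) mulr0 add0r => /eqP.
rewrite mulf_eq0 (negPf h1) orbF => /eqP->.
by rewrite scale0r addr0 memvZ ?memv_line.
Qed.

Variables X1 X2 : 'rV[R]_2.
Hypotheses (c1 : dd sg1 p X1 \in f p) (c2 : dd sg2 p X2 \in f p).
Hypotheses (n1 : dd sg1 p X2 \notin f p) (n2 : dd sg2 p X1 \notin f p).
Hypothesis Xspan : forall X, exists x y, X = x *: X1 + y *: X2.
Let u1 := dd sg1 p X2.
Let u2 := dd sg2 p X1.
Hypothesis u12 : mink u1 u2 = 0.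

Let u1f : u1 \in perp (f p).
Proof. exact: legendre_derive_perp fL (conj oU Up) sg1U. Qed.

Let u2f : u2 \in perp (f p).
Proof. exact: legendre_derive_perp fL (conj oU Up) sg2U. Qed.

(** The quotient of the orthogonal of [f p] by [f p] is definite. *)
Lemma norm_u1 : mink u1 u1 != 0.
Proof. by apply: contra n1 => /eqP /(null_perp_mem (fi (p := p)) dim_f u1f). Qed.

Lemma norm_u2 : mink u2 u2 != 0.
Proof. by apply: contra n2 => /eqP /(null_perp_mem (fi (p := p)) dim_f u2f). Qed.

Lemma dd_polar X : dd S0 p X - (a *: dd sg1 p X + b *: dd sg2 p X) \in f p.
Proof.
exact: (tensorial_comb X (legendre_tensorial fL) (section_near_on polar_section_f Up)
  (section_near_on sg1U Up) (section_near_on sg2U Up) S0p).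
Qed.

Lemma dd_polar1 : dd S0 p X1 - b *: u2 \in f p.
Proof.
have := dd_polar X1; rewrite [X in _ - X]addrC.
by move/mem_sub_comb; apply; exact: memvZ.
Qed.

Lemma dd_polar2 : dd S0 p X2 - a *: u1 \in f p.
Proof.
by apply: mem_sub_comb (dd_polar X2) _; exact: memvZ.
Qed.

Let dS0f X : dd S0 p X \in perp (f p).
Proof. exact: legendre_derive_perp fL (conj oU Up) polar_section_f. Qed.

Lemma mink_polar11 : mink (dd S0 p X1) (dd S0 p X1) = b * b * mink u2 u2.
Proof. exact: mink_mod2 dd_polar1 dd_polar1 (dS0f X1) u2f. Qed.

Lemma mink_polar22 : mink (dd S0 p X2) (dd S0 p X2) = a * a * mink u1 u1.
Proof. exact: mink_mod2 dd_polar2 dd_polar2 (dS0f X2) u1f. Qed.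

Lemma mink_polar12 : mink (dd S0 p X1) (dd S0 p X2) = 0.
Proof.
apply: etrans (mink_mod2 dd_polar1 dd_polar2 (dS0f X2) u2f) _.
by rewrite u12 mulr0.
Qed.

Let a0 : a != 0. Proof. exact: h2. Qed.
Let b0 : b != 0. Proof. by rewrite oppr_eq0. Qed.

Lemma polar_norm1 : mink (dd S0 p X1) (dd S0 p X1) != 0.
Proof. by rewrite mink_polar11; exact: mulf_neq0 (mulf_neq0 b0 b0) norm_u2. Qed.

Lemma polar_norm2 : mink (dd S0 p X2) (dd S0 p X2) != 0.
Proof. by rewrite mink_polar22; exact: mulf_neq0 (mulf_neq0 a0 a0) norm_u1. Qed.

(** Same argument as for [legendre_tensorial], with the derivatives of [S0] as test
vectors: they satisfy the contact condition for the transform on all of [U]. *)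
Lemma fhat_tensorial : tensorial fhat p.
Proof.
move=> s X [U' [oU' Up'] sU'] s0.
have oUU := openI oU oU'; have UUp : (U `&` U') p by split.
have ss := smooth_on_sub (@subIsetr _ U U') sU'.1.
have ortho t : smooth_on U t -> (forall x, (U `&` U') x -> mink (s x) (t x) = 0) ->
    mink (dd s p X) (t p) = 0.
  move=> /(smooth_on_sub (@subIsetl _ U U')) st st0.
  by rewrite (mink_dd X oUU UUp ss st st0) s0 mink0l oppr0.
have sfh x : (U `&` U') x -> s x \in fhat x by move=> [_ U'x]; exact: sU'.2.
(* [dd S0] is orthogonal to the sections of the transform near [p], so this pairing
   can be differentiated although [dd S0] is no section of the transform *)
have orthodd Y : mink (dd S0 p Y) (dd s p X) = 0.
  pose c := chart_at p; have ac := chart_at_atlas p; have pO := cmap_chart_im UUp.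
  have oO := open_chart_im (c := c) oUU.
  have SC : Cinfty (chart_im c (U `&` U')) (S0 \o cinv c).
    by apply: Cinfty_sub (polar_section_f.1 c ac) => y [cy []].
  have := derive_zero_mink X oO pO (Cinfty_differentiable (ss c ac) pO)
    (Cinfty_differentiable (Cinfty_derive Y oO SC) pO).
  rewrite minkC; apply; last by rewrite /= cmapK ?s0 //; exact: chart_at_dom.
  move=> y [cy [Uy U'y]]; rewrite (derive_chart Y ac oU polar_section_f.1 (conj cy Uy)).
  have /perpP := polar_section_contact (chart_vector c Y y) Uy.
  by apply; exact: sfh.
apply: (orthogonal_frame_mem _ dim_fhat (polar_section_contact X1 Up)
  (polar_section_contact X2 Up) polar_norm1 polar_norm2 mink_polar12) => //.
  by move=> u w; exact: fhat_isotropic.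
apply/perpP => u /fhat_span [x [y ->]]; rewrite !minkl ![mink _ (dd s p X)]minkC.
rewrite (ortho S0) ?(ortho H) ?mulr0 ?addr0 //.
- exact: HU.1.
- move=> x' Ux'; apply: (fhat_isotropic (x := x')); [by case: Ux'|exact: sfh|].
  by apply: parallel_section_fhat.2; case: Ux'.
- exact: polar_section_f.1.
move=> x' Ux'; apply: (fhat_isotropic (x := x')); [by case: Ux'|exact: sfh|].
by apply: polar_section_fhat.2; case: Ux'.
Qed.

Lemma polar_indep x y :
  x *: dd S0 p X1 + y *: dd S0 p X2 \in fhat p -> x = 0 /\ y = 0.
Proof.
move=> xyF; have pair X : mink (x *: dd S0 p X1 + y *: dd S0 p X2) (dd S0 p X) = 0.
  by have /perpP := polar_section_contact X Up; apply.
exact: orthogonal_comb0 polar_norm1 polar_norm2 mink_polar12 (pair X1) (pair X2).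
Qed.

(** The vector [k *: v - m *: (eta p X *m H p)] lies in [f p] as it is orthogonal to [f p],
[u1] and [u2]; it is also orthogonal to [H p], and such vectors of [f p] belong to the
Darboux transform. *)
Lemma curvature_equation X k v : v \in perp (f p) -> v \in perp (fhat p) ->
  mink u1 (k *: v - m *: (eta p X *m H p)) = 0 ->
  mink u2 (k *: v - m *: (eta p X *m H p)) = 0 ->
  dd H p X + k *: v \in fhat p.
Proof.
move=> /perpP vf /perpP vfh; set w := k *: _ - _ => w1 w2.
have [j ->] := parallel_dd X Up; apply/fhatP => //.
exists w, j; split; last by rewrite /w addrC addrCA addrC.
  apply: (orthogonal_frame_mem (fi (p := p)) dim_f u1f u2f norm_u1 norm_u2 u12 _ w1 w2).
  apply/perpP => z zf.
  rewrite /w minkDr minkZr vf // mulr0 add0r minkNr minkZr minkC.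
  by rewrite (wedge_perp_skew _ _ _ _ ev) (wedge_perp_ker _ fi ev zf) mink0r oppr0 mulr0 oppr0.
rewrite /w minkDl minkZl minkNl minkZl (minkC v) vfh; last exact: section_near_mem Hn.
have /eqP := wedge_perp_skew p X (H p) (H p) ev; rewrite -addr_eq0 [in X in _ + X]minkC.
by rewrite -mulr2n mulrn_eq0 /= => /eqP ->; rewrite !mulr0 subr0.
Qed.

Hypothesis m0 : m != 0.
Variables p1 r1 p2 r2 : R.
Hypotheses (e1 : eta p X1 *m u1 = 0) (e2 : eta p X2 *m u2 = 0).
Hypothesis E2 : eta p X1 *m u2 = p1 *: sg1 p + r1 *: sg2 p.
Hypothesis E1 : eta p X2 *m u1 = p2 *: sg1 p + r2 *: sg2 p.
Hypothesis rel : r2 * mink u2 u2 = - (p1 * mink u1 u1).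

Let pair_eta X u x y : eta p X *m u = x *: sg1 p + y *: sg2 p ->
  mink u (eta p X *m H p) = x * b - y * a.
Proof.
move=> E; rewrite minkC (wedge_perp_skew _ _ _ _ ev) E minkC minkDl !minkZl -/a.
by rewrite opprD -mulrN.
Qed.

Let pair_eta0 X u : eta p X *m u = 0 -> mink u (eta p X *m H p) = 0.
Proof.
by move=> E; rewrite minkC (wedge_perp_skew _ _ _ _ ev) E mink0r oppr0.
Qed.

(** Pairing with [u1] and [u2] determines the coefficients [a1] and [a2] of the curvature
spheres, and [umbilic_frame] compares them. *)
Lemma umbilic_darboux : umbilic fhat p <->
  p2 * b ^+ 2 * mink u2 u2 + r1 * a ^+ 2 * mink u1 u1 = 0.
Proof.
pose N1 := mink u1 u1; pose N2 := mink u2 u2.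
(* solutions of the equations that [curvature_equation] gives on pairing with the
   one of [u1] and [u2] that is not killed *)
pose a1 := m * (p1 * b - r1 * a) / (b * N2).
pose a2 := m * (p2 * b - r2 * a) / (a * N1).
have N10 : N1 != 0 := norm_u1.
have N20 : N2 != 0 := norm_u2.
have comb X k z y : mink z (dd S0 p X) = y -> k * y = m * mink z (eta p X *m H p) ->
    mink z (k *: dd S0 p X - m *: (eta p X *m H p)) = 0.
  by move=> zy E; rewrite minkDr minkNr !minkZr zy E subrr.
have eq X k := @curvature_equation X k _ (dS0f X) (polar_section_contact X Up).
have k1 : dd H p X1 + a1 *: dd S0 p X1 \in fhat p.
  apply: eq.
    apply: comb (etrans (minkC _ _) (mink_mod dd_polar1 u1f)) _.
    by rewrite (pair_eta0 e1) minkC u12 !mulr0.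
  apply: comb (etrans (minkC _ _) (mink_mod dd_polar1 u2f)) _.
  by rewrite (pair_eta E2) /a1 divfK // mulf_neq0.
have k2 : dd H p X2 + a2 *: dd S0 p X2 \in fhat p.
  apply: eq.
    apply: comb (etrans (minkC _ _) (mink_mod dd_polar2 u1f)) _.
    by rewrite (pair_eta E1) /a2 divfK // mulf_neq0.
  apply: comb (etrans (minkC _ _) (mink_mod dd_polar2 u2f)) _.
  by rewrite (pair_eta0 e2) u12 !mulr0.
apply: iff_trans (umbilic_frame fhat_tensorial S0n Hn fhat_span fhat_free Xspan k1 k2
  polar_indep) _.
exact (@darboux_algebra R m a b p1 r1 p2 r2 N1 N2 m0 a0 b0 N10 N20 rel).
Qed.

End DarbouxTransform.

(** * The quadratic differential as a trace *)

Definition pick2 (T : Type) (x y : T) (k : 'I_2) := if k == 0 then x else y.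

Section QuadraticDifferential.
Variables (R : realType) (Sigma : surface R) (f : Sigma -> {vspace 'cV[R]_6}).
Variables (eta : Sigma -> {linear 'rV[R]_2 -> 'M[R]_6}).
Variables (q : Sigma -> 'rV[R]_2 -> 'rV[R]_2 -> R) (p : Sigma) (sg : 'I_2 -> Sigma -> 'cV[R]_6).
Hypotheses (fT : tensorial f p) (ker : forall X v, v \in f p -> eta p X *m v = 0).
Hypothesis sgn : forall k, section_near f p (sg k).
Hypothesis fspan : forall v, v \in f p -> exists c : 'I_2 -> R, v = \sum_k c k *: sg k p.
Hypothesis ffree : forall c : 'I_2 -> R, \sum_k c k *: sg k p = 0 -> forall k, c k = 0.

Let frame_mx (s : 'I_2 -> 'cV[R]_6) : 'M[R]_(6, 2) := \matrix_(i, k) s k i 0.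

Let frame_mxE s c : frame_mx s *m c = \sum_k c k 0 *: s k.
Proof.
apply/colP => i; rewrite mxE summxE; apply: eq_bigr => k _.
by rewrite !mxE mulrC.
Qed.

(** In the definition of the quadratic differential the frame may be any local frame;
by tensoriality the endomorphism only depends on the values at [p]. *)
Lemma quadratic_differential_trace X Y (M : 'M[R]_2) :
  quadratic_differential f eta q ->
  (forall j, eta p X *m dd (sg j) p Y = \sum_k M k j *: sg k p) -> q p X Y = \tr M.
Proof.
move=> /(_ p X Y) [s [A [sn sb sE ->]]] ME.
have /fin_all_exists [c cE] j : exists c : 'I_2 -> R, s j p = \sum_k c k *: sg k p.
  exact: fspan (section_near_mem (sn j)).
pose P : 'M[R]_2 := \matrix_(k, j) c j k.
pose E := frame_mx (fun k => sg k p); pose S := frame_mx (fun k => s k p).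
have frame_mx_col (B : 'M[R]_(6, 2)) (t : 'I_2 -> 'cV[R]_6) :
    (forall j, col j B = t j) -> B = frame_mx t.
  by move=> Bt; apply/matrixP => i j; rewrite mxE -Bt mxE.
apply: (@trace_frame _ _ E S M A P).
- by move=> v; rewrite frame_mxE => /ffree v0; apply/colP => k; rewrite v0 mxE.
- move=> v; rewrite frame_mxE => /(free_ord_sum (basis_free sb)) v0.
  by apply/colP => k; rewrite v0 mxE.
- apply/esym/frame_mx_col => j; rewrite col_mulmx frame_mxE cE.
  by apply: eq_bigr => k _; rewrite !mxE.
have -> : S *m A = frame_mx (fun j => eta p X *m dd (s j) p Y).
  apply: (frame_mx_col) => j; rewrite col_mulmx frame_mxE sE.
  by apply: eq_bigr => k _; rewrite mxE.
apply: (frame_mx_col) => j; rewrite mulmxA col_mulmx.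
have EM : E *m M = frame_mx (fun k => eta p X *m dd (sg k) p Y).
  apply: (frame_mx_col) => k; rewrite col_mulmx frame_mxE ME.
  by apply: eq_bigr => l _; rewrite mxE.
have Pc k : col j P k 0 = c j k by rewrite !mxE.
rewrite EM frame_mxE sum_ord2 !Pc.
have := tensorial_comb Y fT (sn j) (sgn _) (sgn _) (etrans (cE j) (sum_ord2 _)).
move=> /(ker X); rewrite mulmxBr => /subr0_eq ->.
exact/esym/mulmx_comb.
Qed.

End QuadraticDifferential.

Lemma quadratic_differential_trace2 (R : realType) (Sigma : surface R)
    (f : Sigma -> {vspace 'cV[R]_6}) (eta : Sigma -> {linear 'rV[R]_2 -> 'M[R]_6})
    q p sg1 sg2 X Y x11 x21 x12 x22 :
  tensorial f p -> (forall X v, v \in f p -> eta p X *m v = 0) ->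
  section_near f p sg1 -> section_near f p sg2 ->
  (forall v, v \in f p -> exists a b, v = a *: sg1 p + b *: sg2 p) ->
  (forall a b, a *: sg1 p + b *: sg2 p = 0 -> a = 0 /\ b = 0) ->
  quadratic_differential f eta q ->
  eta p X *m dd sg1 p Y = x11 *: sg1 p + x21 *: sg2 p ->
  eta p X *m dd sg2 p Y = x12 *: sg1 p + x22 *: sg2 p ->
  q p X Y = x11 + x22.
Proof.
move=> fT ker n1 n2 span free fq E1 E2.
pose M : 'M[R]_2 := \matrix_(k, j) pick2 (pick2 x11 x12 j) (pick2 x21 x22 j) k.
have ord2 (k : 'I_2) : k = 0 \/ k = 1.
  by case: k => [[|[|k]] //= hk]; [left|right]; exact/val_inj.
have -> : x11 + x22 = \tr M by rewrite /mxtrace sum_ord2 !mxE.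
apply: (quadratic_differential_trace (sg := pick2 sg1 sg2) fT ker) => //.
- by move=> k; case: (ord2 k) => ->.
- by move=> v /span [a [b ->]]; exists (pick2 a b); rewrite sum_ord2.
- by move=> c; rewrite sum_ord2 => /free [c0 c1] k; case: (ord2 k) => ->.
by move=> j; rewrite sum_ord2 !mxE; case: (ord2 j) => ->.
Qed.

(** * Complexified lines *)

Section Complexification.
Variable R : realType.
Local Notation V := 'cV[R]_6.

Lemma complexvZ (a : R) (v : V) : complexv (a *: v) = real_complex R a *: complexv v.
Proof. exact: map_mxZ. Qed.

Lemma complexvD (u v : V) : complexv (u + v) = complexv u + complexv v.
Proof. exact: map_mxD. Qed.

Lemma complexv_sum n (v : 'I_n -> V) : complexv (\sum_i v i) = \sum_i complexv (v i).
Proof. exact: (raddf_sum (map_mx (real_complex R))). Qed.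

Lemma memv_complexify (L : {vspace V}) v : v \in L -> complexv v \in complexify L.
Proof.
move=> vL; rewrite (coord_vbasis vL) complexv_sum memv_suml // => i _.
rewrite complexvZ memvZ // memv_span // map_f //.
by apply: mem_nth; rewrite size_tuple.
Qed.

Lemma complexify_line (v : V) : complexify <[v]>%VS = <[complexv v]>%VS.
Proof.
apply/eqP; rewrite eqEsubv -memvE memv_complexify ?memv_line // andbT.
apply/span_subvP => _ /mapP [w /vbasis_mem /vlineP [k ->] ->].
by rewrite complexvZ memvZ ?memv_line.
Qed.

(** Real and imaginary parts of a complex relation are real relations. *)
Lemma complexv_free (u v : V) :
  (forall a b : R, a *: u + b *: v = 0 -> a = 0 /\ b = 0) ->
  forall x y : R[i], x *: complexv u + y *: complexv v = 0 -> x = 0 /\ y = 0.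
Proof.
move=> uv [x1 x2] [y1 y2] E.
have e i : (x1 * u i 0 + y1 * v i 0 = 0) /\ (x2 * u i 0 + y2 * v i 0 = 0).
  have /colP/(_ i) := E; rewrite !mxE.
  rewrite -[LHS]/(Complex _ _) => /eqP; rewrite eq_complex /= => /andP[/eqP e1 /eqP e2].
  split; [rewrite -[RHS]e1|rewrite -[RHS]e2]; ring.
have [-> ->] : x1 = 0 /\ y1 = 0.
  by apply: uv; apply/colP => i; rewrite !mxE; case: (e i).
have [-> ->] : x2 = 0 /\ y2 = 0.
  by apply: uv; apply/colP => i; rewrite !mxE; case: (e i).
by [].
Qed.

End Complexification.

(** * Umbilics of the Darboux transform *)

(** Over the complex numbers the real condition factors, up to sign, as
[N1 * N2 * (b - e * a) * (b + e * a)]. *)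
Lemma isothermic_algebra (R : realType) (e : R[i]) (neg : bool) (a b r p N1 N2 : R) :
  N1 != 0 -> N2 != 0 ->
  real_complex R r = (-1) ^+ neg * - (e ^+ 2 * real_complex R N2) ->
  real_complex R p = (-1) ^+ neg * real_complex R N1 ->
  p * b ^+ 2 * N2 + r * a ^+ 2 * N1 = 0 <->
  real_complex R b = e * real_complex R a \/ real_complex R b = - e * real_complex R a.
Proof.
move=> N10 N20; set C := real_complex R => rE pE.
have E : C (p * b ^+ 2 * N2 + r * a ^+ 2 * N1) =
    (-1) ^+ neg * C N1 * C N2 * ((C b - e * C a) * (C b + e * C a)).
  have CD x y : C (x + y) = C x + C y by exact: rmorphD.
  have CM x y : C (x * y) = C x * C y by exact: rmorphM.
  rewrite CD !CM rE pE; ring.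
have C0 x : (C x == 0) = (x == 0) by exact: fmorph_eq0.
have -> : (p * b ^+ 2 * N2 + r * a ^+ 2 * N1 = 0) <->
    (C b - e * C a) * (C b + e * C a) = 0.
  split=> [z|z]; last by apply/eqP; rewrite -C0 E z mulr0.
  have C00 : C 0 = 0 by exact: rmorph0.
  move: E; rewrite z C00 => /esym/eqP; rewrite mulf_eq0 => /orP[|/eqP//].
  by rewrite !mulf_eq0 signr_eq0 !C0 (negPf N10) (negPf N20).
rewrite mulNr; split=> [/eqP|].
  by rewrite mulf_eq0 subr_eq0 addr_eq0 => /orP[] /eqP; [left|right].
by case=> ->; rewrite ?subrr ?mul0r // addNr mulr0.
Qed.

Theorem proposition4p15 (R : realType) (Sigma : surface R)
    (f : Sigma -> {vspace 'cV[R]_6})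
    (eta : Sigma -> {linear 'rV[R]_2 -> 'M[R]_6})
    (q : Sigma -> 'rV[R]_2 -> 'rV[R]_2 -> R)
    (m : R) (fhat : Sigma -> {vspace 'cV[R]_6})
    (U : set Sigma) (splus sminus : Sigma -> {vspace 'cV[R[i]]_6}) (p : Sigma) :
  lie_applicable_with f eta q ->
  umbilic_free f ->
  constant_signature q ->
  darboux_transform f eta m fhat ->
  open_nbhs p U ->
  isothermic_sphere_congruences q f U splus sminus ->
  umbilic fhat p <->
  complexify (f p :&: fhat p)%VS = splus p \/
  complexify (f p :&: fhat p)%VS = sminus p.
Proof.
move=> [fL [es ev ecl] _ fq _] _ _ [m0 [shat [sb sn spar sorth fhE]]] [oU Up].
move=> [s1 [s2 [T1 [T2 [q1 [q2 [sg1 [sg2 [eps [neg [cs _ qE [s1U s2U sg0 q2E q1E] spm]]]]]]]]]]].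
have -> : fhat = (fun x => (perp (shat x) :&: f x + shat x)%VS) by exact/funext.
have [U1 [h [[oU1 U1p] hU hb]]] := sb p.
pose H := h ord0; have [oW Wp] : open (U `&` U1) /\ (U `&` U1) p.
  by split; [exact: openI|split].
have HW : section_on shat (U `&` U1) H := section_on_sub (@subIsetr _ _ _) (hU ord0).
have shatE x : (U `&` U1) x -> shat x = <[H x]>%VS.
  move=> [_ U1x]; rewrite -(span_basis (hb x U1x)) span_def big_map big_enum /=.
  by rewrite big_ord1.
have [c1s c2s s12 t1 t2] := cs p Up; have [s10 s20] := sg0 p Up.
have s1E : s1 p = <[sg1 p]>%VS.
  case: c1s => d _ _; apply/esym/eqP; rewrite eqEdim -memvE s1U.2 //.
  by rewrite dim_vline s10 d.
have s2E : s2 p = <[sg2 p]>%VS.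
  case: c2s => d _ _; apply/esym/eqP; rewrite eqEdim -memvE s2U.2 //.
  by rewrite dim_vline s20 d.
have sf (L : Sigma -> {vspace _}) s : section_on L U s ->
    (forall x, U x -> curvature_sphere f x (L x)) -> section_on f U s.
  move=> [ss sL] Lc; split=> // x Ux; have [_ /subvP Lf _] := Lc x Ux.
  exact/Lf/sL.
have f1U : section_on f U sg1 by apply: (sf) s1U _ => x /cs [].
have f2U : section_on f U sg2 by apply: (sf) s2U _ => x /cs [].
have f1n : section_near f p sg1 by exists U.
have f2n : section_near f p sg2 by exists U.
have free12 a b : a *: sg1 p + b *: sg2 p = 0 -> a = 0 /\ b = 0.
  by apply: distinct_lines_free => //; rewrite -s1E -s2E.
have dimf : \dim (f p) = 2%N by case: fL => sb2 _ _ _; exact: dim_subbundle sb2.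
have span12 := frame2_span dimf (section_near_mem f1n) (section_near_mem f2n) free12.
have north (s : {vspace _}) w : curvature_sphere f p s -> s = <[w]>%VS -> mink w (H p) != 0.
  move=> cw sw; apply/eqP => wH; apply: (sorth p s cw); rewrite sw -memvE.
  by apply/perpP => u; rewrite shatE // => /vlineP[k ->]; rewrite minkZl minkC wH mulr0.
have h1 := north _ _ c1s s1E; have h2 := north _ _ c2s s2E.
have [X1 X10 X1T] := curvature_direction c1s t1.
have [X2 X20 X2T] := curvature_direction c2s t2.
have cX1 : dd sg1 p X1 \in f p by case: t1 => c _; exact: c X1T f1n (s1U.2 _ Up).
have cX2 : dd sg2 p X2 \in f p by case: t2 => c _; exact: c X2T f2n (s2U.2 _ Up).
have ft := legendre_tensorial (p := p) fL.
(* the immersion condition, which a frame of sections suffices to test *)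
have imm X : dd sg1 p X \in f p -> dd sg2 p X \in f p -> X = 0.
  move=> x1 x2; have [_ _ _ im] := fL; apply: im => s sn'.
  have [a [b sE]] := span12 _ (section_near_mem sn').
  have := tensorial_comb X ft sn' f1n f2n sE.
  by move/memvD/(_ (memvD (memvZ a x1) (memvZ b x2))); rewrite subrK.
have n1 : dd sg1 p X2 \notin f p by apply: contra X20 => /imm ->.
have n2 : dd sg2 p X1 \notin f p by apply: contra X10 => /(imm _ cX1) ->.
have freeX x y : x *: X1 + y *: X2 = 0 -> x = 0 /\ y = 0.
  apply: distinct_lines_free => //; apply: contra n1 => /eqP E.
  have : X2 \in <[X1]>%VS by rewrite E memv_line.
  by move=> /vlineP[k ->]; rewrite (dd_scale _ _ f1n) memvZ.
have dim2 : \dim {: 'rV[R]_2} = 2%N by rewrite dimvf /dim /= mul1n.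
have Xspan X := frame2_span dim2 (memvf X1) (memvf X2) freeX (memvf X).
have [u12 e1 e2 rel] := curvature_relations fL es ev ecl (conj oU Up) f1U f2U cX1 cX2.
have fi : isotropic f by case: fL.
have eper X v : v \in perp (f p) -> eta p X *m v \in f p by exact: wedge_perp_mem.
have u1p : dd sg1 p X2 \in perp (f p) by exact: legendre_derive_perp fL (conj oU Up) f1U.
have u2p : dd sg2 p X1 \in perp (f p) by exact: legendre_derive_perp fL (conj oU Up) f2U.
have [p1 [r1 E2]] := span12 _ (eper X1 _ u2p).
have [p2 [r2 E1]] := span12 _ (eper X2 _ u1p).
have f1W := section_on_sub (@subIsetl _ U U1) f1U.
have f2W := section_on_sub (@subIsetl _ U U1) f2U.
apply: iff_trans (umbilic_darboux fL ev oW f1W f2W HW shatE sn spar Wp h1 h2 span12 free12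
  cX1 cX2 n1 n2 Xspan u12 m0 e1 e2 E2 E1 (rel _ _ _ _ E2 E1)) _.
have -> := meet_fhat fL oW f1W f2W HW shatE Wp h1 h2 span12.
have N1 := norm_u1 fL oW f1W f2W Wp span12 free12 n1.
have N2 := norm_u2 fL oW f1W f2W Wp span12 free12 n2.
set a := mink (sg2 p) (H p); set b := - mink (sg1 p) (H p).
have cfree := complexv_free free12.
have ac0 : real_complex R a != 0 by rewrite fmorph_eq0.
rewrite complexify_line complexvD !complexvZ; have [-> ->] := spm p Up.
rewrite -scaleNr.
have [qd1 qd2 qEp] := qE p Up.
have ker X v : v \in f p -> eta p X *m v = 0 by exact: wedge_perp_ker.
have z v : v \in f p -> forall X, eta p X *m v = 0 *: sg1 p + 0 *: sg2 p.
  by move=> vf X; rewrite ker // !scale0r addr0.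
have qt X Y := quadratic_differential_trace2 (X := X) (Y := Y) ft ker f1n f2n span12 free12 fq.
have qr : q p X1 X1 = r1 := etrans (qt _ _ _ _ _ _ (z _ cX1 X1) E2) (add0r r1).
have qp : q p X2 X2 = p2 := etrans (qt _ _ _ _ _ _ E1 (z _ cX2 X2)) (addr0 p2).
have rE : real_complex R r1 =
    (-1) ^+ neg * - (eps ^+ 2 * real_complex R (mink (dd sg2 p X1) (dd sg2 p X1))).
  have [_ _ q20 _] := qd2; rewrite -qr qEp (q20 _ _ X1T) addr0 mulNr.
  have [->|e0] := eqVneq eps 0; first by rewrite expr0n /= !mul0r.
  by move: q1E; rewrite (negPf e0) => ->.
have pE : real_complex R p2 = (-1) ^+ neg * real_complex R (mink (dd sg1 p X2) (dd sg1 p X2)).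
  have [_ _ q10 _] := qd1; rewrite -qp qEp (q10 _ _ X2T) mulr0 add0r.
  by rewrite q2E.
apply: iff_trans (isothermic_algebra a b N1 N2 rE pE) _.
by split=> -[] h'; [left|right|left|right]; apply/(line_frame_eq _ _ cfree ac0).
Qed.
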